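(* Let $X\in\mathbb R^{n\times p}$ be fixed with $X_{S_0}^TX_{S_0}$ invertible, and let $Y=X\beta^0+\epsilon$ with $\epsilon$ a vector of i.i.d. standard Gaussians. Take, for some $t>0$, $$\lambda>\|v_{-S_0}\|_\infty\sqrt{2(\log(2p)+t)} .$$ Define $$\bar v_j:=v_j\sqrt{2(\log(2p)+t)}/\lambda,\ j\notin S_0,\qquad \bar u_j:=u_j\sqrt{2(\log(2p)+t)}/\lambda,\ j\in S_0,$$ where $\{u_j^2\}_{j\in S_0}$ ($u_j\ge 0$) are the diagonal elements of $(X_{S_0}^TX_{S_0})^{-1}$. Assume that $\hat\kappa(1+\bar v,S_0)>0$ and that the following betamin condition holds: $$|\beta_j^0|>\lambda\left(\mathbf b_j(\bar v)+\bar u_j\right),\qquad \mathrm{sign}(\beta_j^0)=z_j^*(\bar v),\qquad\text{for all } j\in S_0 .$$ Then for all $x>0$, with probability at least $1-\exp[-t]-\exp[-x]$, there is a solution $\hat\beta$ of the KKT conditions $$X^TX(\hat\beta-\beta^0)+\lambda\hat\zeta=X^T\epsilon,\qquad\hat\zeta\in\partial\|\hat\beta\|_1,$$ such that $$\|X(\hat\beta-\beta^0)\|_2\ge\sqrt{\frac{s_0}{\hat\kappa^2(1+\bar v,S_0)}}\sqrt{\frac{\lambda^2}{n}}-\sqrt{s_0}-\sqrt{2x}.$$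
   Context: $\beta^0\in\mathbb R^p$, $S_0:=\{j:\beta_j^0\ne0\}$ (nonempty), $s_0:=|S_0|$. For $S\subset\{1,\dots,p\}$: $b_S$ denotes the vector with entries $b_j1\{j\in S\}$ (or its restriction to $S$), $b_{-S}:=b_{S^c}$; $X_S$ is the matrix of columns of $X$ indexed by $S$, $X_{-S}:=X_{S^c}$. $\partial\|b\|_1=\{z:\ z^Tb=\|b\|_1,\ \|z\|_\infty\le1\}$. The KKT conditions are those of the Lasso $\min_b\{\|Y-Xb\|_2^2+2\lambda\|b\|_1\}$. For a vector $w\in\mathbb R^{p-s_0}$ of non-negative weights (indexed by $S_0^c$) and $W=\mathrm{diag}(w)$, $\hat\kappa(w,S_0)\ge0$ is defined by $\hat\kappa^2(w,S_0):=\min\{s_0\|Xb\|_2^2/n:\ \|b_{S_0}\|_1-\|Wb_{-S_0}\|_1=1\}$; $1+\bar v$ is the vector with entries $1+\bar v_j$. $\{v_j^2\}_{j\notin S_0}$ ($v_j\ge0$) are the diagonal elements of $X_{-S_0}^T\bigl(I-X_{S_0}(X_{S_0}^TX_{S_0})^{-1}X_{S_0}^T\bigr)X_{-S_0}$, and $v_{-S_0}=(v_j)_{j\notin S_0}$. Given $\bar v$, put $\mathcal W(\bar v):=\{w\in\mathbb R^{p-s_0}:\ 1-\bar v_j\le w_j\le1+\bar v_j\ \forall j\}$, $\bar W:=\mathrm{diag}(1+\bar v)$, $$b^*(\bar v)\in\arg\min\{\|Xb\|_2^2:\ \|b_{S_0}\|_1-\|\bar Wb_{-S_0}\|_1=1\},\qquad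 z_j^*(\bar v):=\mathrm{sign}(b_j^*(\bar v)),\ j\in S_0 .$$ For $w\in\mathcal W(\bar v)$, with $W=\mathrm{diag}(w)$, let $$b(w)\in\arg\min\{\|Xb\|_2^2:\ z_{S_0}^{*T}(\bar v)b_{S_0}-\|Wb_{-S_0}\|_1\ge1\},$$ and $\mathbf b_j(\bar v):=\max_{w\in\mathcal W(\bar v)}|b_j(w)|/\|Xb(w)\|_2^2$, $j\in S_0$. *)

(* Defs.v *)
From HB Require Import structures.
From mathcomp Require Import all_boot all_order all_algebra.
From mathcomp Require Import all_classical all_reals all_analysis.

Set Implicit Arguments.
Unset Strict Implicit.
Unset Printing Implicit Defensive.
Import Order.TTheory GRing.Theory Num.Theory.
Import numFieldNormedType.Exports.

Local Open Scope classical_set_scope.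
Local Open Scope ring_scope.

(* On column vectors `|v| is the sup norm (MathComp-Analysis' matrix norm). *)
Definition norm1 (R : realType) (m : nat) (v : 'cV[R]_m) : R :=
  \sum_i `|v i 0|.

Definition norm2 (R : realType) (m : nat) (v : 'cV[R]_m) : R :=
  Num.sqrt (\sum_i v i 0 ^+ 2).

Definition subdiff_norm1 (R : realType) (m : nat) (b z : 'cV[R]_m) : Prop :=
  (z^T *m b) 0 0 = norm1 b /\ `|z| <= 1.

Definition is_argmin (R : realType) (T : Type) (f : T -> R) (A : set T) (a : T)
    : Prop :=
  A a /\ forall b, A b -> f a <= f b.

Definition active_set (R : realType) (p : nat) (b : 'cV[R]_p) : {set 'I_p} :=
  finset (fun j => b j 0 != 0).

(* Vectors indexed by S have type 'cV_#|S|; the k-th coordinate corresponds to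
   the index enum_val k of S. *)
Definition vsub (R : realType) (p : nat) (b : 'cV[R]_p) (S : {set 'I_p})
    : 'cV[R]_#|S| :=
  rowsub (@enum_val _ (mem S)) b.

Definition xsub (R : realType) (n p : nat) (X : 'M[R]_(n, p)) (S : {set 'I_p})
    : 'M[R]_(n, #|S|) :=
  colsub (@enum_val _ (mem S)) X.

Definition gram (R : realType) (n p : nat) (X : 'M[R]_(n, p)) (S : {set 'I_p})
    : 'M[R]_#|S| :=
  (xsub X S)^T *m xsub X S.

Definition resid_gram (R : realType) (n p : nat) (X : 'M[R]_(n, p))
    (S : {set 'I_p}) : 'M[R]_#|~: S| :=
  (xsub X (~: S))^T
    *m (1%:M - xsub X S *m invmx (gram X S) *m (xsub X S)^T)
    *m xsub X (~: S).

(* The diagonals below are nonnegative when gram X S is invertible, so these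
   are the nonnegative vectors whose squares are the diagonals. *)
Definition vvec (R : realType) (n p : nat) (X : 'M[R]_(n, p)) (S : {set 'I_p})
    : 'cV[R]_#|~: S| :=
  \col_k Num.sqrt (resid_gram X S k k).

Definition uvec (R : realType) (n p : nat) (X : 'M[R]_(n, p)) (S : {set 'I_p})
    : 'cV[R]_#|S| :=
  \col_k Num.sqrt (invmx (gram X S) k k).

Definition wnorm1 (R : realType) (p : nat) (S : {set 'I_p})
    (w : 'cV[R]_#|~: S|) (b : 'cV[R]_p) : R :=
  norm1 (diag_mx w^T *m vsub b (~: S)).

Definition compat_set (R : realType) (p : nat) (S : {set 'I_p})
    (w : 'cV[R]_#|~: S|) : set 'cV[R]_p :=
  [set b | norm1 (vsub b S) - wnorm1 w b = 1].

(* The infimum is attained for nonempty S: compat_set w is a finite union of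
   polyhedra and the objective is a convex quadratic bounded below. *)
Definition kappa_hat (R : realType) (n p : nat) (X : 'M[R]_(n, p))
    (S : {set 'I_p}) (w : 'cV[R]_#|~: S|) : R :=
  Num.sqrt (inf [set #|S|%:R * norm2 (X *m b) ^+ 2 / n%:R | b in compat_set w]).

Definition weight_set (R : realType) (m : nat) (vbar : 'cV[R]_m)
    : set 'cV[R]_m :=
  [set w | forall k, 1 - vbar k 0 <= w k 0 <= 1 + vbar k 0].

Definition sign_set (R : realType) (p : nat) (S : {set 'I_p})
    (z : 'cV[R]_#|S|) (w : 'cV[R]_#|~: S|) : set 'cV[R]_p :=
  [set b | 1 <= (z^T *m vsub b S) 0 0 - wnorm1 w b].

(* Division is taken in \bar R, where a positive number divided by 0 is +oo:
   a weight w with X b(w) = 0 makes the bound infinite at some k (for the b(w)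
   in sign_set z w), instead of contributing the value 0 of x / 0 in R. *)
Definition bbound (R : realType) (n p : nat) (X : 'M[R]_(n, p))
    (S : {set 'I_p}) (vbar : 'cV[R]_#|~: S|)
    (b : 'cV[R]_#|~: S| -> 'cV[R]_p) (k : 'I_#|S|) : \bar R :=
  ereal_sup [set (`|vsub (b w) S k 0|%:E / (norm2 (X *m b w) ^+ 2)%:E)%E
            | w in weight_set vbar].

Definition lasso_kkt (R : realType) (n p : nat) (X : 'M[R]_(n, p))
    (beta0 : 'cV[R]_p) (e : 'cV[R]_n) (lambda : R) (betah : 'cV[R]_p) : Prop :=
  exists2 zeta : 'cV[R]_p,
    X^T *m X *m (betah - beta0) + lambda *: zeta = X^T *m e &
    subdiff_norm1 betah zeta.

Definition mutually_independent (R : realType) (d : measure_display)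
    (T : measurableType d) (P : probability T R) (n : nat)
    (eps : 'I_n -> {RV P >-> R}) : Prop :=
  forall (J : {set 'I_n}) (B : 'I_n -> set R),
    (forall i, measurable (B i)) ->
    P (\bigcap_(i in [set` J]) eps i @^-1` B i)
      = (\prod_(i in J) P (eps i @^-1` B i))%E.

Definition iid_std_gaussian (R : realType) (d : measure_display)
    (T : measurableType d) (P : probability T R) (n : nat)
    (eps : 'I_n -> {RV P >-> R}) : Prop :=
  mutually_independent eps /\
  forall i (B : set R), measurable B ->
    distribution P (eps i) B = normal_prob (0 : R) 1 B.

(* Main.v *)
(* Let Pi = X_S G^-1 X_S^T with S = S_0 and G = X_S^T X_S, and split the noise
   into Pi eps and (1 - Pi) eps. Shifting by the least squares coefficients
   G^-1 X_S^T eps turns the KKT conditions into those of a noiseless problem in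
   which z^T b_S is rewarded and the penalty on the other coordinates is
   |b_j| + vh_j b_j, where vh = X^T (1 - Pi) eps / lambda. On the event
   |vh_j| <= vbar_j a solution b' of the normalized problem is, for the symmetric
   weights w_j = 1 + vh_j sign(b'_j) (and 1 + vbar_j where b'_j = 0), also a
   minimizer of the problem defining b(w); by strict convexity X b(w) = X b', and
   the subgradient found at b' is one at b(w). Hence
     betah = beta0 + G^-1 X_S^T eps - lambda b(w) / |X b(w)|^2
   solves the KKT conditions, the betamin condition keeping its signs on S, and
   |X (betah - beta0)| >= lambda / |X b(w)| - |Pi eps|, |X b(w)| <= |X bstar|.
   The probabilities are Chernoff bounds for p Gaussian linear forms and for the
   chi-square variable |Pi eps|^2 with s_0 degrees of freedom. *)

Require Import Defs.
From HB Require Import structures.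
From mathcomp Require Import all_boot all_order all_algebra.
From mathcomp Require Import all_classical all_reals all_analysis.
From mathcomp Require Import measurable_realfun ring lra.
Import Order.TTheory GRing.Theory Num.Theory.
Import numFieldNormedType.Exports.
Local Open Scope classical_set_scope.
Local Open Scope ring_scope.

Set Implicit Arguments.
Unset Strict Implicit.
Unset Printing Implicit Defensive.

(** * Euclidean geometry and nonnegative least squares *)

Section DotProduct.
Context {R : realType} {m : nat}.
Implicit Types u v w : 'cV[R]_m.

Definition dotv u v : R := (u^T *m v) 0 0.

Lemma dotvE u v : dotv u v = \sum_i u i 0 * v i 0.
Proof. by rewrite /dotv mxE; apply: eq_bigr => i _; rewrite mxE. Qed.

Lemma dotvC u v : dotv u v = dotv v u.
Proof. by rewrite !dotvE; apply: eq_bigr => i _; rewrite mulrC. Qed.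

Lemma dotvDl u v w : dotv (u + v) w = dotv u w + dotv v w.
Proof. by rewrite /dotv linearD /= mulmxDl mxE. Qed.

Lemma dotvDr u v w : dotv w (u + v) = dotv w u + dotv w v.
Proof. by rewrite /dotv mulmxDr mxE. Qed.

Lemma dotvZl a u v : dotv (a *: u) v = a * dotv u v.
Proof. by rewrite /dotv linearZ /= -scalemxAl mxE. Qed.

Lemma dotvZr a u v : dotv u (a *: v) = a * dotv u v.
Proof. by rewrite dotvC dotvZl dotvC. Qed.

Lemma dotvNl u v : dotv (- u) v = - dotv u v.
Proof. by rewrite -scaleN1r dotvZl mulN1r. Qed.

Lemma dotvNr u v : dotv u (- v) = - dotv u v.
Proof. by rewrite dotvC dotvNl dotvC. Qed.

Lemma dotv0l u : dotv 0 u = 0.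
Proof. by rewrite -(scale0r u) dotvZl mul0r. Qed.

Lemma dotvv_ge0 u : 0 <= dotv u u.
Proof. by rewrite dotvE sumr_ge0// => i _; rewrite -expr2 sqr_ge0. Qed.

Lemma dotvv_eq0 u : dotv u u = 0 -> u = 0.
Proof.
rewrite dotvE => /eqP; rewrite psumr_eq0; last first.
  by move=> i _; rewrite -expr2 sqr_ge0.
move=> /allP u0; apply/matrixP => i j; rewrite mxE (ord1 j).
by have /u0 := mem_index_enum i; rewrite /= mulf_eq0 orbb => /eqP.
Qed.

Lemma norm2_sqr u : norm2 u ^+ 2 = dotv u u.
Proof.
rewrite /norm2 sqr_sqrtr; last by apply: sumr_ge0 => i _; rewrite sqr_ge0.
by rewrite dotvE; apply: eq_bigr => i _; rewrite expr2.
Qed.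

Lemma norm2_ge0 u : 0 <= norm2 u.
Proof. exact: sqrtr_ge0. Qed.

Lemma dotv_delta u i : dotv (delta_mx i 0) u = u i 0.
Proof.
rewrite dotvE (bigD1 i)//= mxE !eqxx mul1r big1 ?addr0// => j /negPf ji.
by rewrite mxE ji mul0r.
Qed.

End DotProduct.

Lemma dotv_mulmx (R : realType) (m n : nat) (A : 'M[R]_(m, n)) u v :
  dotv (A *m u) v = dotv u (A^T *m v).
Proof. by rewrite /dotv trmx_mul mulmxA. Qed.

Lemma norm2_triangle (R : realType) (m : nat) (u v : 'cV[R]_m) :
  norm2 (u + v) <= norm2 u + norm2 v.
Proof.
have CS : dotv u v <= norm2 u * norm2 v.
  have [v0|v0] := eqVneq (norm2 v) 0.
    have /dotvv_eq0 -> : dotv v v = 0 by rewrite -norm2_sqr v0 expr0n.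
    by rewrite dotvC dotv0l mulr_ge0 ?norm2_ge0.
  have [u0|u0] := eqVneq (norm2 u) 0.
    have /dotvv_eq0 -> : dotv u u = 0 by rewrite -norm2_sqr u0 expr0n.
    by rewrite dotv0l mulr_ge0 ?norm2_ge0.
  have := dotvv_ge0 (norm2 v *: u - norm2 u *: v).
  rewrite !(dotvDl, dotvDr, dotvZl, dotvZr, dotvNl, dotvNr) (dotvC v u).
  rewrite -!norm2_sqr; set d := dotv u v.
  have un0 : 0 < norm2 u * norm2 v by rewrite mulr_gt0// lt0r ?u0 ?v0 norm2_ge0.
  set a := norm2 u in un0 *; set c := norm2 v in un0 *; move=> h.
  have : 0 <= (2 * (a * c)) * (a * c - d) by move: h; congr (_ <= _); ring.
  have ac0 : 0 < 2 * (a * c) by rewrite mulr_gt0.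
  by rewrite (pmulr_rge0 _ ac0) subr_ge0.
rewrite -ler_sqr ?nnegrE ?addr_ge0 ?norm2_ge0//.
rewrite sqrrD !norm2_sqr !dotvDl !dotvDr (dotvC v u) mulr2n.
lra.
Qed.

(** [G] may be singular. The columns of [cokermx G] lie in the kernel of [G], hence in that of [M],
    because |M x|^2 = x^T G x; this places (M^T c)^T in the row space of the symmetric matrix
    [G]. *)
Lemma normal_equation (R : realType) (m n : nat) (M : 'M[R]_(m, n))
    (c : 'cV[R]_m) :
  exists y : 'cV_n, M^T *m (M *m y) = M^T *m c.
Proof.
set G := M^T *m M.
have kerG : M *m cokermx G = 0.
  have GK : G *m cokermx G = 0 by exact: mulmx_coker.
  apply/matrixP => i j; set K := M *m _.
  have : dotv (col j K) (col j K) = 0.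
    rewrite colE /K -mulmxA dotv_mulmx (mulmxA M^T) -/G mulmxA GK mul0mx.
    by rewrite dotvE big1// => k _; rewrite !mxE mulr0.
  by move/dotvv_eq0/matrixP/(_ i 0); rewrite !mxE.
have /submxP[D eqD] : ((M^T *m c)^T <= G)%MS.
  by rewrite submxE trmx_mul trmxK -mulmxA kerG mulmx0.
exists D^T; rewrite mulmxA -/G; apply: trmx_inj; rewrite eqD trmx_mul trmxK.
by rewrite /G trmx_mul trmxK.
Qed.

Section NonnegativeLeastSquares.
Context {R : realType} {m n : nat} (M : 'M[R]_(m, n)) (c : 'cV[R]_m).
Implicit Types (I : {set 'I_n}) (h x y z : 'cV[R]_n).

Let f y := dotv (M *m y - c) (M *m y - c).
Let g y := M^T *m (M *m y - c).

Let supported I y := forall i, i \notin I -> y i 0 = 0.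
(** Minimizers of [f] over the vectors supported in [I], since [g] is half the gradient of [f]. The
    passive sets of the active-set method are those whose minimizer can be taken nonnegative. *)
Let ls_on I y := supported I y /\ forall i, i \in I -> g y i 0 = 0.
Let passive I y := ls_on I y /\ forall i, 0 <= y i 0.

Let f_shift y h : f (y + h) = f y + 2 * dotv h (g y) + dotv (M *m h) (M *m h).
Proof.
rewrite /f mulmxDr addrAC /g -dotv_mulmx.
move: (M *m y - c) => r.
by rewrite dotvDl !dotvDr (dotvC r (M *m h)); ring.
Qed.

Let supported_dot0 I y h : ls_on I y -> supported I h -> dotv h (g y) = 0.
Proof.
move=> [_ gy0] hI; rewrite dotvE big1// => i _.
by have [/gy0->|/hI->] := boolP (i \in I); rewrite ?mulr0 ?mul0r.
Qed.

Let supportedB I x y : supported I x -> supported I y -> supported I (x - y).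
Proof. by move=> Hx Hy i iI; rewrite !mxE Hx// Hy// subr0. Qed.

(** The normal equation is solved for [M *m D], with [D] the coordinate projection on [I]; applying
    [D] to the solution gives the support. *)
Let ls_on_exists I : exists y, ls_on I y.
Proof.
pose D : 'M[R]_n := diag_mx (\row_i (i \in I)%:R).
have [y0 Hy] := normal_equation (M *m D) c.
have Dcoord y i : (D *m y) i 0 = (i \in I)%:R * y i 0.
  rewrite mxE (bigD1 i)//= big1 ?addr0; last first.
    by move=> j ji; rewrite mxE mxE eq_sym (negPf ji) mulr0n mul0r.
  by rewrite mxE mxE eqxx mulr1n.
exists (D *m y0); split=> [i iI|i iI]; first by rewrite Dcoord (negPf iI) mul0r.
have : (M *m D)^T *m (M *m (D *m y0) - c) = 0.
  by rewrite mulmxBr (mulmxA M) Hy subrr.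
rewrite trmx_mul -mulmxA -/(g _) tr_diag_mx -/D.
by move/matrixP/(_ i 0); rewrite Dcoord iI mul1r => ->; rewrite mxE.
Qed.

Let f_ls_le I y z : ls_on I y -> supported I z -> f y <= f z.
Proof.
move=> yls zI; rewrite -(subrK y z) addrC f_shift.
rewrite (supported_dot0 yls) ?mulr0 ?addr0 ?lerDl ?dotvv_ge0//.
by apply: supportedB => //; case: yls.
Qed.

(* Moving from [y] towards the least squares point on its support decreases [f]
   until a coordinate vanishes, after which the support has shrunk. *)
Let descend k I y : (#|I| <= k)%N -> supported I y -> (forall i, 0 <= y i 0) ->
  exists I' y', passive I' y' /\ f y' <= f y.
Proof.
elim: k I y => [|k IHk] I y Ik yI y0; have [z zls] := ls_on_exists I.
- exists I, z; split; last exact: f_ls_le zls yI.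
  split=> // i; case: zls => -> // ; move: Ik; rewrite leqn0 cards_eq0 => /eqP ->.
  by rewrite inE.
have [/forallP z0|] := boolP [forall i, 0 <= z i 0].
  by exists I, z; split; [split|exact: f_ls_le zls yI].
rewrite negb_forall => /existsP[i0]; rewrite -ltNge => zi0.
(* The fraction of the segment from [y] to [z] after which coordinate [i] vanishes. Its minimum over
   the negative coordinates of [z] is the longest step that keeps all entries nonnegative. *)
pose th i := y i 0 / (y i 0 - z i 0).
have [i2 zi2 thmin] : exists2 i, z i 0 < 0 &
    forall j, z j 0 < 0 -> th i <= th j.
  by case: (@arg_minP _ _ _ i0 (fun i => z i 0 < 0) th zi0) => i; exists i.
have d2 : 0 < y i2 0 - z i2 0 by rewrite subr_gt0 (lt_le_trans zi2 (y0 i2)).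
have th0 : 0 <= th i2 by exact: divr_ge0 (y0 _) (ltW d2).
have th1 : th i2 <= 1 by rewrite ler_pdivrMr// mul1r lerDl oppr_ge0 ltW.
have i2I : i2 \in I.
  by apply: contraTT zi2 => /(proj1 zls) ->; rewrite ltxx.
pose y' := y + th i2 *: (z - y).
have y'E i : y' i 0 = y i 0 + th i2 * (z i 0 - y i 0) by rewrite !mxE.
have fy' : f y' <= f y.
  (* Around the least squares point [z] the linear term of [f] vanishes, and the quadratic term is
     multiplied by (1 - th)^2 <= 1. *)
  have -> : y' = z + (1 - th i2) *: (y - z).
    by apply/matrixP => i j; rewrite !mxE; ring.
  have -> : f y = f (z + (y - z)) by rewrite addrC subrK.
  have yzI : supported I (y - z) by apply: supportedB => //; case: zls.
  rewrite !f_shift dotvZl !(supported_dot0 zls yzI) !mulr0 !addr0 lerD2l.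
  rewrite -scalemxAr dotvZl dotvZr; set q := dotv _ _.
  have q0 : 0 <= q by exact: dotvv_ge0.
  by rewrite mulrA ler_piMl// -expr2 exprn_ile1//; lra.
have [I' [y'' [Hpass fle]]] : exists I' y'', passive I' y'' /\ f y'' <= f y'.
  apply: (IHk (I :\ i2)).
  - by move: Ik; rewrite (cardsD1 i2) i2I.
  - move=> i; rewrite in_setD1 negb_and negbK => /orP[/eqP ->|iI].
      by rewrite y'E /th; field; rewrite gt_eqF.
    by rewrite y'E yI// (proj1 zls)//; ring.
  - move=> i; rewrite y'E; have [zi|zi] := leP 0 (z i 0).
      have -> : y i 0 + th i2 * (z i 0 - y i 0) =
        (1 - th i2) * y i 0 + th i2 * z i 0 by ring.
      by rewrite addr_ge0// mulr_ge0// subr_ge0.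
    have di : 0 < y i 0 - z i 0 by rewrite subr_gt0 (lt_le_trans zi (y0 i)).
    by have := thmin _ zi; rewrite /(th i) ler_pdivlMr//; nra.
by exists I', y''; split => //; exact: le_trans fy'.
Qed.

(** Existence by finiteness instead of compactness: among the finitely many passive sets one with
    the smallest value of [f] is chosen, and [descend] makes it optimal over the whole nonnegative
    orthant. Nonnegativity of the gradient is first-order optimality along each coordinate. *)
Lemma nnls_kkt : exists y, [/\ forall i, 0 <= y i 0,
  forall i, 0 <= (M^T *m (M *m y - c)) i 0 &
  forall i, y i 0 * (M^T *m (M *m y - c)) i 0 = 0].
Proof.
pose Y I := xget 0 [set y | passive I y].
have YP I y : passive I y -> passive I (Y I).
  by move=> Iy; apply: (@xgetPex _ 0 [set y | passive I y]); exists y.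
have pass0 : `[< passive finset.set0 (Y finset.set0) >].
  apply/asboolP/(YP _ 0); split; last by move=> i; rewrite mxE.
  by split=> i; rewrite ?mxE// inE.
have [I0 I0p fmin] : exists2 I, passive I (Y I) &
    forall I', passive I' (Y I') -> f (Y I) <= f (Y I').
  case: (@arg_minP _ _ _ finset.set0 (fun I => `[< passive I (Y I) >])
    (fun I => f (Y I)) pass0) => I /asboolP Ip Imin.
  by exists I => // I' ?; apply: Imin; apply/asboolP.
exists (Y I0); have [[YI0 gI0] Y0] := I0p.
have gmin y : (forall i, 0 <= y i 0) -> f (Y I0) <= f y.
  move=> y0; have [||I' [y' [y'p fy']]] := @descend _ finset.setT y (leqnn _).
  - by move=> i; rewrite inE.
  - by [].
  apply: le_trans fy'; apply: (le_trans (fmin I' (YP _ _ y'p))).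
  by case: (YP _ _ y'p) => Yls _; apply: (f_ls_le Yls); case: y'p => -[].
split=> // i; rewrite -/(g _); last first.
  by have [/gI0->|/YI0->] := boolP (i \in I0); rewrite ?mulr0 ?mul0r.
rewrite leNgt; apply/negP => gi.
set q := dotv (M *m delta_mx i 0) (M *m delta_mx i 0).
have q0 : 0 <= q by exact: dotvv_ge0.
set G := g (Y I0) i 0 in gi *.
(* With this step [f] changes by 2 s G + s^2 q = - s^2 (q + 2) < 0; the [+ 1] covers a zero column
   of [M]. *)
pose s := - G / (q + 1).
have s0 : 0 < s by rewrite divr_gt0//; lra.
have : f (Y I0) <= f (Y I0 + s *: delta_mx i 0).
  by apply: gmin => j; rewrite !mxE addr_ge0// mulr_ge0 ?ler0n ?ltW.
rewrite f_shift -scalemxAr !dotvZl dotvZr -/q dotv_delta -/G.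
have sq : s * (q + 1) = - G by rewrite /s; field; lra.
nra.
Qed.

End NonnegativeLeastSquares.

(** * The noiseless weighted problem *)

(* Nonnegative least squares on the columns [(X_j, a1_j)] and [(- X_j, a2_j)]
   with target [(0, 1)]: the two halves of the solution are the positive and
   negative parts of [b], and [mu] is the residual in the last coordinate. *)
Lemma sign_lasso_exists (R : realType) (n p : nat) (X : 'M[R]_(n, p))
    (S : {set 'I_p}) (z v : 'cV[R]_p) :
  (exists2 j, j \in S & z j 0 != 0) ->
  (forall j, j \notin S -> `|v j 0| <= 1) ->
  (forall b : 'cV[R]_p, X *m b = 0 ->
     \sum_(j in S) z j 0 * b j 0
       - \sum_(j | j \notin S) (1 - `|v j 0|) * `|b j 0| < 1) ->
  exists (b zeta q : 'cV[R]_p) (m : R),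
    [/\ 0 < m, X^T *m (X *m b) = m *: q, dotv q b = 1,
        forall j, j \in S -> q j 0 = z j 0 &
        forall j, j \notin S ->
          [/\ q j 0 = - (zeta j 0 + v j 0), `|zeta j 0| <= 1 &
              zeta j 0 * b j 0 = `|b j 0| ]].
Proof.
move=> [j0 j0S zj0] v1 nodeg.
(* The last row of [M] makes [s] below the reward z^T b_S minus the split penalty (1 + v_j) y1_j +
   (1 - v_j) y2_j off [S]. *)
pose a1 : 'cV[R]_p := \col_j (if j \in S then z j 0 else - (1 + v j 0)).
pose a2 : 'cV[R]_p := \col_j (if j \in S then - z j 0 else - (1 - v j 0)).
have a1S j : j \in S -> a1 j 0 = z j 0 by rewrite mxE => ->.
have a2S j : j \in S -> a2 j 0 = - z j 0 by rewrite mxE => ->.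
have a1C j : j \notin S -> a1 j 0 = - (1 + v j 0).
  by rewrite mxE => /negPf->.
have a2C j : j \notin S -> a2 j 0 = - (1 - v j 0).
  by rewrite mxE => /negPf->.
pose M : 'M[R]_(n + 1, p + p) :=
  col_mx (row_mx X (- X)) (row_mx a1^T a2^T).
have [y [y0 gy0 ygy0]] := nnls_kkt M (col_mx 0 (const_mx 1)).
pose y1 := usubmx y; pose y2 := dsubmx y; pose b := y1 - y2.
pose s := dotv a1 y1 + dotv a2 y2; pose mu := 1 - s.
pose h := X^T *m (X *m b).
have gE : M^T *m (M *m y - col_mx 0 (const_mx 1)) =
    col_mx (h - mu *: a1) (- h - mu *: a2).
  rewrite /M -[y]vsubmxK -/y1 -/y2 mul_col_mx !mul_row_col opp_col_mx.
  rewrite add_col_mx.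
  rewrite tr_col_mx !tr_row_mx !trmxK mul_row_col !mul_col_mx add_col_mx.
  rewrite subr0 mulNmx -mulmxBr -/b !linearN /= mulNmx -/h.
  have -> : a1^T *m y1 + a2^T *m y2 - const_mx 1 = ((- mu)%:M : 'M[R]_1).
    apply/matrixP => i j; rewrite !ord1 !mxE /= mulr1n /mu /s !dotvE.
    have trE (a c : 'cV[R]_p) :
        \sum_k a^T 0 k * c k 0 = \sum_k a k 0 * c k 0.
      by apply: eq_bigr => k _; rewrite mxE.
    by rewrite !trE; ring.
  by rewrite !mul_mx_scalar !scaleNr.
rewrite gE in gy0 ygy0.
have y1E j : y (lshift p j) 0 = y1 j 0 by rewrite mxE.
have y2E j : y (rshift p j) 0 = y2 j 0 by rewrite mxE.
have y1_ge0 j : 0 <= y1 j 0 by rewrite -y1E.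
have y2_ge0 j : 0 <= y2 j 0 by rewrite -y2E.
have g1 j : 0 <= h j 0 - mu * a1 j 0.
  by have := gy0 (lshift p j); rewrite col_mxEu !mxE.
have g2 j : 0 <= - h j 0 - mu * a2 j 0.
  by have := gy0 (rshift p j); rewrite col_mxEd !mxE.
have c1 j : y1 j 0 * (h j 0 - mu * a1 j 0) = 0.
  by have := ygy0 (lshift p j); rewrite col_mxEu y1E !mxE.
have c2 j : y2 j 0 * (- h j 0 - mu * a2 j 0) = 0.
  by have := ygy0 (rshift p j); rewrite col_mxEd y2E !mxE.
have bE j : b j 0 = y1 j 0 - y2 j 0 by rewrite !mxE.
(* Summed complementary slackness. With [hbX] it gives |X b|^2 = mu (1 - mu), so [mu] lies in
   [0, 1]; both ends are excluded next. *)
have hb : dotv h b = mu * s.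
  rewrite dotvE /s !dotvE -big_split /= mulr_sumr; apply: eq_bigr => j _.
  by have := c1 j; have := c2 j; rewrite bE; nra.
have hbX : dotv h b = dotv (X *m b) (X *m b).
  by rewrite [RHS]dotv_mulmx dotvC.
have s_mu : s = 1 - mu by rewrite /mu; ring.
have mu01 : 0 <= mu * (1 - mu) by rewrite -s_mu -hb hbX dotvv_ge0.
have h0 : X *m b = 0 -> forall j, h j 0 = 0.
  by move=> Xb j; rewrite /h Xb mulmx0 mxE.
have mu_ge0 : 0 <= mu by nra.
(* At [mu = 0] the vector [b] would be a null vector of [X] whose reward minus penalty is at least
   1, against [nodeg]. *)
have mu_neq0 : mu != 0.
  apply/eqP => mu0.
  have Xb0 : X *m b = 0 by apply: dotvv_eq0; rewrite -hbX hb mu0 mul0r.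
  have := nodeg b Xb0; rewrite ltNge => /negP; apply.
  have s1 : s = 1 by rewrite s_mu mu0 subr0.
  rewrite -[X in X <= _]s1 /s !dotvE -big_split /= (bigID (mem S))/= lerD//.
    apply: ler_sum => j jS; rewrite bE a1S// a2S//; lra.
  rewrite -sumrN; apply: ler_sum => j jS; rewrite bE a1C// a2C//.
  have b_le : `|y1 j 0 - y2 j 0| <= y1 j 0 + y2 j 0.
    by rewrite (le_trans (ler_normB _ _))// !ger0_norm.
  have /andP[vl vu] : - `|v j 0| <= v j 0 <= `|v j 0| by rewrite -ler_norml.
  have t1 : 0 <= (1 - `|v j 0|) * (y1 j 0 + y2 j 0 - `|y1 j 0 - y2 j 0|).
    by rewrite mulr_ge0 ?subr_ge0// v1.
  have t2 : 0 <= (`|v j 0| + v j 0) * y1 j 0 by rewrite mulr_ge0//; lra.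
  have t3 : 0 <= (`|v j 0| - v j 0) * y2 j 0 by rewrite mulr_ge0//; lra.
  lra.
(* At [mu = 1] again X b = 0, so [h] vanishes and the two gradient inequalities at [j0] force z_j0 =
   0. *)
have mu_neq1 : mu != 1.
  apply/eqP => mu1.
  have Xb0 : X *m b = 0 by apply: dotvv_eq0; rewrite -hbX hb s_mu mu1 subrr mulr0.
  have := g1 j0; have := g2 j0; rewrite h0// mu1 a1S// a2S// => z1 z2.
  by move/eqP: zj0; apply; lra.
have mu_gt0 : 0 < mu by rewrite lt0r mu_neq0.
have mu_lt1 : mu < 1.
  by rewrite lt_neqAle mu_neq1 -subr_ge0 -(pmulr_rge0 _ mu_gt0).
(* Dividing [b] by s = 1 - mu and [h] by [mu] normalizes q^T b = 1; [m] is then |X b|^2 for the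
   rescaled [b]. *)
pose m := mu / (1 - mu).
have s1 : 0 < 1 - mu by rewrite subr_gt0.
have hS j : j \in S -> h j 0 = mu * z j 0.
  by move=> jS; have := g1 j; have := g2 j; rewrite a1S// a2S//; lra.
pose zeta : 'cV[R]_p := \col_j (- (mu^-1 * h j 0) - v j 0).
have zetaE j : zeta j 0 = - (mu^-1 * h j 0) - v j 0 by rewrite mxE.
have scaleE (a : R) (u : 'cV[R]_p) j : (a *: u) j 0 = a * u j 0 by rewrite mxE.
exists ((1 - mu)^-1 *: b), zeta, (mu^-1 *: h), m.
split.
- by rewrite divr_gt0.
- by rewrite -!scalemxAr -/h scalerA; congr (_ *: _); rewrite /m; field;
    rewrite mu_neq0 gt_eqF.
- by rewrite dotvZl dotvZr hb s_mu; field; rewrite mu_neq0 gt_eqF.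
- by move=> j jS; rewrite scaleE hS// mulKf.
move=> j jS.
have hj : mu^-1 * h j 0 * mu = h j 0 by field.
move: (g1 j) (g2 j) (c1 j) (c2 j); rewrite a1C// a2C// zetaE !scaleE.
move: hj; set k := mu^-1 * h j 0 => <- g1j g2j c1j c2j.
have k1 : k <= 1 - v j 0.
  by rewrite -(ler_pM2r mu_gt0); move: g2j; lra.
have k2 : - (1 + v j 0) <= k.
  by rewrite -(ler_pM2r mu_gt0); move: g1j; lra.
split; first by ring.
- by rewrite ler_norml; apply/andP; split; lra.
rewrite bE normrM gtr0_norm ?invr_gt0//.
rewrite [LHS]mulrCA; congr (_ * _).
have e1 : y1 j 0 * (k + 1 + v j 0) = 0.
  by apply: (mulfI mu_neq0); move: c1j; lra.
have e2 : y2 j 0 * (k - 1 + v j 0) = 0.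
  by apply: (mulfI mu_neq0); move: c2j; lra.
have [y1z|y1nz] := eqVneq (y1 j 0) 0.
  rewrite y1z sub0r normrN ger0_norm//; lra.
(* The positive and negative parts cannot both be nonzero: this would need k = -1 - v_j and k = 1 -
   v_j at once. *)
have -> : y2 j 0 = 0.
  move/eqP: e1; rewrite mulf_eq0 (negPf y1nz)/= => /eqP e1.
  have : k = - 1 - v j 0 by lra.
  by move=> ke; move: e2; rewrite ke; lra.
by rewrite subr0 ger0_norm//; lra.
Qed.

(** * Coordinates indexed by a set, and the projection on the selected columns *)

Lemma exists_enum_val (T : finType) (S : {set T}) j :
  j \in S -> exists k : 'I_#|S|, j = enum_val k.
Proof. by move=> jS; exists (enum_rank_in jS j); rewrite enum_rankK_in. Qed.

Lemma vsubE (R : realType) (p : nat) (b : 'cV[R]_p) (S : {set 'I_p}) k i :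
  vsub b S k i = b (enum_val k) 0.
Proof. by rewrite mxE (ord1 i). Qed.

Definition embed (R : realType) (p : nat) (S : {set 'I_p}) : 'M[R]_(p, #|S|) :=
  colsub (@enum_val _ (mem S)) 1%:M.

Lemma xsub_embed (R : realType) (n p : nat) (X : 'M[R]_(n, p)) S :
  xsub X S = X *m embed R S.
Proof. by rewrite mulmx_colsub mulmx1. Qed.

Lemma embed_val (R : realType) (p : nat) (S : {set 'I_p}) (u : 'cV[R]_#|S|) k :
  (embed R S *m u) (enum_val k) 0 = u k 0.
Proof.
rewrite mxE (bigD1 k)//= !mxE eqxx mul1r big1 ?addr0// => i /negPf ik.
by rewrite !mxE (inj_eq enum_val_inj) eq_sym ik mul0r.
Qed.

Lemma embed_out (R : realType) (p : nat) (S : {set 'I_p}) (u : 'cV[R]_#|S|) j :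
  j \notin S -> (embed R S *m u) j 0 = 0.
Proof.
move=> jS; rewrite mxE big1// => i _; rewrite !mxE.
case: eqP => [ji|]; last by rewrite mul0r.
by move: jS; rewrite ji enum_valP.
Qed.

Lemma wnorm1E (R : realType) (p : nat) (S : {set 'I_p}) (w : 'cV[R]_#|~: S|) b :
  wnorm1 w b = \sum_k `|w k 0| * `|b (enum_val k) 0|.
Proof.
rewrite /wnorm1 /norm1; apply: eq_bigr => k _.
by rewrite mul_diag_mx 2!mxE vsubE normrM.
Qed.

Lemma mx_norm_le (R : realType) (m : nat) (v : 'cV[R]_m) (c : R) :
  0 <= c -> (forall i, `|v i 0| <= c) -> `|v| <= c.
Proof.
move=> c0 vc; rewrite [`|v|]mx_normrE; apply: bigmax_le => // -[i j] _ /=.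
by rewrite (ord1 j).
Qed.

Lemma le_mx_norm (R : realType) (m : nat) (v : 'cV[R]_m) i : `|v i 0| <= `|v|.
Proof.
rewrite [leRHS]mx_normrE.
exact: (le_bigmax 0 (fun k : 'I_m * 'I_1 => `|v k.1 k.2|) (i, 0)).
Qed.

(** For invertible [gram X S], the orthogonal projection onto the span of the columns in [S]. *)
Definition colproj (R : realType) (n p : nat) (X : 'M[R]_(n, p)) (S : {set 'I_p})
    : 'M[R]_n :=
  xsub X S *m invmx (gram X S) *m (xsub X S)^T.

Lemma xsub_proj (R : realType) (n p : nat) (X : 'M[R]_(n, p)) S :
  gram X S \in unitmx -> (xsub X S)^T *m colproj X S = (xsub X S)^T.
Proof.
by move=> Gu; rewrite /colproj !mulmxA -/(gram X S) mulmxV// mul1mx.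
Qed.

Section BetaMin.
Context {R : realType} {n p : nat} {X : 'M[R]_(n, p)} {S : {set 'I_p}}.
Context {lambda : R} {vbar : 'cV[R]_#|~: S|} {b : 'cV[R]_#|~: S| -> 'cV[R]_p}.

(** The supremum is instantiated at [w] and the bound carried from extended to real numbers. A
    nonzero coordinate over a zero denominator would contribute [+oo], which the finite [beta]
    forbids; hence the second conclusion. *)
Lemma bbound_lt k (u beta : R) w : 0 < lambda -> weight_set vbar w ->
  (lambda%:E * (bbound X vbar b k + u%:E) < beta%:E)%E ->
  lambda * (`|b w (enum_val k) 0| / norm2 (X *m b w) ^+ 2 + u) < beta /\
  (norm2 (X *m b w) ^+ 2 = 0 -> b w (enum_val k) 0 = 0).
Proof.
move=> lam0 Ww; set a := `|b w (enum_val k) 0|; set c := norm2 _ ^+ 2 => lt_beta.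
have le_bb : (a%:E / c%:E <= bbound X vbar b k)%E.
  by apply: ereal_sup_ubound; exists w => //; rewrite vsubE.
have lt_beta' : (lambda%:E * (a%:E / c%:E + u%:E) < beta%:E)%E.
  by apply: le_lt_trans lt_beta; rewrite lee_pmul2l// leeD2r.
have c_a : c = 0 -> b w (enum_val k) 0 = 0.
  move=> c0; apply/eqP; apply: contraT => b0.
  have a0 : 0 < a by rewrite normr_gt0.
  by move: lt_beta'; rewrite c0 inve0 gt0_muley ?lte_fin// addye// gt0_muley.
split=> //.
have [c0|c0] := eqVneq c 0.
  by move: lt_beta'; rewrite {1}/a c_a// c0 normr0 mul0e add0e -EFinM lte_fin
    /a c_a// normr0 mul0r add0r.
by move: lt_beta'; rewrite inver (negPf c0) -!EFinM lte_fin.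
Qed.

End BetaMin.

(** The deterministic part, valid outcome by outcome: the good event enters only through the last
    two bounds. Positivity of |X bstar| is exported because the final comparison divides by it and
    it rules out n = 0. *)
Lemma lasso_solution (R : realType) (n p : nat) (X : 'M[R]_(n, p))
    (beta0 : 'cV[R]_p) (e : 'cV[R]_n) (lambda : R) (bstar : 'cV[R]_p)
    (vbar : 'cV[R]_#|~: active_set beta0|) (ubar : 'cV[R]_#|active_set beta0|)
    (b : 'cV[R]_#|~: active_set beta0| -> 'cV[R]_p) :
  let S := active_set beta0 in
  let zstar := \col_k Num.sg (vsub bstar S k 0) in
  (0 < #|S|)%N -> gram X S \in unitmx -> 0 < lambda ->
  (forall k, 0 <= vbar k 0 < 1) ->
  is_argmin (fun c => norm2 (X *m c) ^+ 2)
    (compat_set (const_mx 1 + vbar)) bstar ->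
  (forall w, weight_set vbar w ->
     is_argmin (fun c => norm2 (X *m c) ^+ 2) (sign_set zstar w) (b w)) ->
  (forall k : 'I_#|S|,
     (lambda%:E * (bbound X vbar b k + (ubar k 0)%:E)
        < `|vsub beta0 S k 0|%:E)%E /\
     Num.sg (vsub beta0 S k 0) = zstar k 0) ->
  (forall k : 'I_#|~: S|, `|(X^T *m ((1%:M - colproj X S) *m e)) (enum_val k) 0|
     <= lambda * vbar k 0) ->
  (forall k : 'I_#|S|, `|(invmx (gram X S) *m (xsub X S)^T *m e) k 0|
     <= lambda * ubar k 0) ->
  0 < norm2 (X *m bstar) /\
  exists2 betah : 'cV[R]_p, lasso_kkt X beta0 e lambda betah &
    lambda / norm2 (X *m bstar) - norm2 (colproj X S *m e)
      <= norm2 (X *m (betah - beta0)).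
Proof.
move=> S zstar S0 Gu lam0 vbar01 [bstarc _] bargmin betamin ev eu.
pose z : 'cV[R]_p := \col_j Num.sg (beta0 j 0).
have inS j : (j \in S) = (beta0 j 0 != 0) by rewrite inE.
have zstarE k : zstar k 0 = z (enum_val k) 0.
  by have [_ <-] := betamin k; rewrite vsubE mxE.
have zbE c : (zstar^T *m vsub c S) 0 0 = \sum_(j in S) z j 0 * c j 0.
  rewrite big_enum_val -/(dotv _ _) dotvE; apply: eq_bigr => k _.
  by rewrite zstarE vsubE.
have sum_out (F : 'I_p -> R) :
    \sum_(j | j \notin S) F j = \sum_(k < #|~: S|) F (enum_val k).
  by rewrite -big_enum_val; apply: eq_bigl => j; rewrite finset.in_setC.
have enum_in (k : 'I_#|S|) : enum_val k \in S by exact: enum_valP.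
have enum_out (k : 'I_#|~: S|) : enum_val k \notin S.
  by have := enum_valP k; rewrite finset.in_setC.
have vbar_ge0 k : 0 <= vbar k 0 by case/andP: (vbar01 k).
have vbar_lt1 k : vbar k 0 < 1 by case/andP: (vbar01 k).
have W_ge0 w : weight_set vbar w -> forall k, 0 <= w k 0.
  move=> Ww k; case/andP: (Ww k) => + _; apply: le_trans.
  by rewrite subr_ge0 ltW.
have sign_setE w c : weight_set vbar w -> sign_set zstar w c <->
    1 <= \sum_(j in S) z j 0 * c j 0
         - \sum_k w k 0 * `|c (enum_val k) 0|.
  move=> Ww; rewrite /sign_set /= zbE wnorm1E.
  suff -> : \sum_k `|w k 0| * `|c (enum_val k) 0| =
    \sum_k w k 0 * `|c (enum_val k) 0| by [].
  by apply: eq_bigr => k _; rewrite (ger0_norm (W_ge0 _ Ww k)).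
(* Otherwise the betamin condition kills every coordinate of [b w] in [S], leaving nothing to reach
   the value 1 that [sign_set] demands. *)
have Xb_neq0 w : weight_set vbar w -> norm2 (X *m b w) ^+ 2 != 0.
  move=> Ww; apply/eqP => Xb0; have [/(sign_setE _ _ Ww) + _] := bargmin _ Ww.
  rewrite big_enum_val big1 => [|k _]; last first.
    have [lt_beta _] := betamin k; have [_ ->//] := bbound_lt lam0 Ww lt_beta.
    by rewrite mulr0.
  rewrite sub0r leNgt => /negP; apply.
  rewrite (@le_lt_trans _ _ 0)// oppr_le0 sumr_ge0// => k _.
  by rewrite mulr_ge0// W_ge0.
have Xb_gt0 w : weight_set vbar w -> 0 < norm2 (X *m b w).
  move=> Ww; rewrite lt0r norm2_ge0 andbT; apply: contra (Xb_neq0 w Ww).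
  by move=> /eqP ->; rewrite expr0n.
(* The signs of [bstar] on [S] are [zstar], so its reward is its full l1 norm on [S], and w <= 1 +
   vbar can only lower the penalty. *)
have bstar_in w : weight_set vbar w -> sign_set zstar w bstar.
  move=> Ww; rewrite /sign_set /= -bstarc lerB//.
    rewrite -/(dotv _ _) dotvE; apply: ler_sum => k _.
    by rewrite [zstar k 0]mxE -normrEsg.
  rewrite !wnorm1E; apply: ler_sum => k _; rewrite ler_wpM2r//.
  rewrite ger0_norm ?W_ge0//; case/andP: (Ww k) => _ wk.
  by rewrite (le_trans wk)// (le_trans (ler_norm _))// !mxE.
have Xb_le w : weight_set vbar w -> norm2 (X *m b w) <= norm2 (X *m bstar).
  move=> Ww; have [_ /(_ _ (bstar_in _ Ww))] := bargmin _ Ww.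
  by rewrite ler_sqr ?nnegrE ?norm2_ge0.
pose vh : 'cV[R]_p := lambda^-1 *: (X^T *m ((1%:M - colproj X S) *m e)).
have vhS j : j \in S -> vh j 0 = 0.
  move=> /exists_enum_val[k ->]; rewrite mxE.
  have -> : (X^T *m ((1%:M - colproj X S) *m e)) (enum_val k) 0 =
      ((xsub X S)^T *m ((1%:M - colproj X S) *m e)) k 0.
    by rewrite !mxE; apply: eq_bigr => i _; rewrite !mxE.
  by rewrite mulmxA mulmxBr mulmx1 (xsub_proj Gu) subrr mul0mx mxE mulr0.
have vh_le (k : 'I_#|~: S|) : `|vh (enum_val k) 0| <= vbar k 0.
  rewrite mxE normrM gtr0_norm ?invr_gt0//.
  by rewrite mulrC ler_pdivrMr// mulrC.
have W1B : weight_set vbar (const_mx 1 - vbar).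
  move=> k; rewrite !mxE lexx /=; have := vbar_ge0 k; lra.
have [b' [zeta [q [m [m0 Hb' qb' qS qC]]]]] :
    exists (b' zeta q : 'cV[R]_p) (m : R),
    [/\ 0 < m, X^T *m (X *m b') = m *: q, dotv q b' = 1,
        forall j, j \in S -> q j 0 = z j 0 &
        forall j, j \notin S ->
          [/\ q j 0 = - (zeta j 0 + vh j 0), `|zeta j 0| <= 1 &
              zeta j 0 * b' j 0 = `|b' j 0| ]].
  apply: sign_lasso_exists.
  - have /card_gt0P[j jS] := S0; exists j => //.
    by rewrite mxE sgr_eq0 -inS.
  - move=> j jS; have [k ->] : exists k : 'I_#|~: S|, j = enum_val k.
      by apply: exists_enum_val; rewrite finset.in_setC.
    by rewrite (le_trans (vh_le k))// ltW.
  (* Nondegeneracy: a null vector [c] of [X] reaching 1 would also be feasible for the smallest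
     weights 1 - vbar, making the minimum there 0 against [Xb_neq0]. *)
  move=> c Xc0; rewrite ltNge; apply/negP => c1.
  have := Xb_neq0 _ W1B; apply/negP; rewrite negbK.
  have cin : sign_set zstar (const_mx 1 - vbar) c.
    apply/(sign_setE _ _ W1B); rewrite (le_trans c1)// lerD2l lerN2 sum_out.
    apply: ler_sum => k _; rewrite ler_wpM2r//.
    by rewrite [leLHS]mxE [X in X + _]mxE [X in _ + X]mxE lerD2l lerN2.
  have [_ /(_ _ cin)] := bargmin _ W1B.
  rewrite Xc0 [X in _ <= X](_ : _ = 0); first by rewrite eq_le sqr_ge0 andbT.
  by rewrite norm2_sqr dotv0l.
(* These weights dominate the asymmetric penalty, with equality at [b']; the
   given [b w] need not be [b'], but its image under [X] is. *)
pose w : 'cV[R]_#|~: S| := \col_k (if b' (enum_val k) 0 == 0 then 1 + vbar k 0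
  else 1 + vh (enum_val k) 0 * Num.sg (b' (enum_val k) 0)).
(* A subgradient at [b'] of the asymmetric penalty |b_j| + vh_j b_j, equal to - q_j off [S]. *)
pose xi (k : 'I_#|~: S|) := zeta (enum_val k) 0 + vh (enum_val k) 0.
have zetaE (k : 'I_#|~: S|) : b' (enum_val k) 0 != 0 ->
    zeta (enum_val k) 0 = Num.sg (b' (enum_val k) 0).
  move=> bk; have [_ _] := qC _ (enum_out k).
  by rewrite normrEsg => /(mulIf bk).
have sg_b' (k : 'I_#|~: S|) : b' (enum_val k) 0 != 0 ->
    (Num.sg (b' (enum_val k) 0) = 1) \/ (Num.sg (b' (enum_val k) 0) = -1).
  by move=> bk; case: sgrP bk => // _ _; [left|right].
have vh_bnd (k : 'I_#|~: S|) : - vbar k 0 <= vh (enum_val k) 0 <= vbar k 0.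
  by rewrite -ler_norml.
have Ww : weight_set vbar w.
  move=> k; rewrite mxE; case: eqP => [_|/eqP bk].
    by rewrite lexx andbT; have := vbar_ge0 k; lra.
  by case/andP: (vh_bnd k) => h1 h2; case: (sg_b' k bk) => ->; lra.
have xi_le k : `|xi k| <= w k 0.
  case/andP: (vh_bnd k) => h1 h2.
  have [_ + _] := qC _ (enum_out k); rewrite ler_norml => /andP[h3 h4].
  rewrite ler_norml mxE /xi; case: eqP => [_|/eqP bk].
    by apply/andP; split; lra.
  have := vbar_lt1 k.
  by rewrite zetaE//; case: (sg_b' k bk) => ->; lra.
have xi_b' k : w k 0 * `|b' (enum_val k) 0| = xi k * b' (enum_val k) 0.
  rewrite mxE /xi; case: eqP => [->|/eqP bk]; first by rewrite normr0 !mulr0.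
  rewrite zetaE// normrEsg.
  by case: (sg_b' k bk) => ->; ring.
have dot_q c : dotv q c = \sum_(j in S) z j 0 * c j 0
    - \sum_k xi k * c (enum_val k) 0.
  rewrite dotvE (bigID (mem S))/=; congr (_ + _).
    by apply: eq_bigr => j jS; rewrite qS.
  rewrite sum_out -sumrN; apply: eq_bigr => k _.
  by have [-> _ _] := qC _ (enum_out k); rewrite mulNr.
have le_w (c : 'cV[R]_p) k : xi k * c (enum_val k) 0 <= w k 0 * `|c (enum_val k) 0|.
  by rewrite (le_trans (ler_norm _))// normrM ler_wpM2r.
have b'in : sign_set zstar w b'.
  apply/(sign_setE _ _ Ww); rewrite -qb' dot_q lerD2l lerN2.
  by apply: ler_sum => k _; rewrite xi_b'.
pose b0 := b w.
have [/(sign_setE _ _ Ww) b0in b0min] := bargmin _ Ww.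
have qb0 : 1 <= dotv q b0.
  rewrite (le_trans b0in)// dot_q lerD2l lerN2.
  by apply: ler_sum => k _; exact: le_w.
have dotX c : dotv (X *m b') (X *m c) = m * dotv q c.
  by rewrite dotvC dotv_mulmx Hb' dotvZr dotvC.
(* The squared distance is |X b0|^2 - 2 m q^T b0 + m, which is at most 0 because |X b0|^2 <= m by
   minimality and q^T b0 >= 1. *)
have Xb0 : X *m b0 = X *m b'.
  apply/eqP; rewrite -subr_eq0; apply/eqP/dotvv_eq0/eqP.
  rewrite eq_le dotvv_ge0 andbT.
  have := b0min _ b'in; rewrite !norm2_sqr !dotX qb' mulr1 => le_m.
  rewrite !dotvDl !dotvDr !dotvNl !dotvNr (dotvC (X *m b0) (X *m b')) !dotX qb'.
  have : m * 1 <= m * dotv q b0 by rewrite ler_wpM2l// ltW.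
  by move: le_m; rewrite /b0; lra.
have qb0_1 : dotv q b0 = 1.
  by apply: (mulfI (lt0r_neq0 m0)); rewrite -dotX Xb0 dotX qb'.
(* Feasibility of [b0] and q^T b0 = 1 leave no room in the nonnegative gaps of [le_w], so each of
   them vanishes. *)
have xi_b0 k : w k 0 * `|b0 (enum_val k) 0| = xi k * b0 (enum_val k) 0.
  apply/eqP; rewrite eq_sym -subr_eq0 -oppr_eq0 opprB; move: k.
  suff /eqP : \sum_k (w k 0 * `|b0 (enum_val k) 0| - xi k * b0 (enum_val k) 0) = 0.
    rewrite psumr_eq0 => [/allP h k|k _]; last by rewrite subr_ge0.
    exact: (h k (mem_index_enum k)).
  apply/eqP; rewrite eq_le; apply/andP; split; last first.
    by apply: sumr_ge0 => k _; rewrite subr_ge0.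
  by move: b0in; rewrite -qb0_1 dot_q big_split /= sumrN; lra.
have zeta_b0 (k : 'I_#|~: S|) :
    zeta (enum_val k) 0 * b0 (enum_val k) 0 = `|b0 (enum_val k) 0|.
  (* If b'_k = 0 the weight is 1 + vbar_k and the equality is the sum of two bounds, both then
     tight. Otherwise the factor 1 + vh_k sg(b'_k) is cancelled; it is positive because vbar_k <
     1. *)
  have := xi_b0 k; rewrite mxE /xi; case: eqP => [_|/eqP bk].
    have [_ z1 _] := qC _ (enum_out k).
    have h1 : zeta (enum_val k) 0 * b0 (enum_val k) 0 <= `|b0 (enum_val k) 0|.
      by rewrite (le_trans (ler_norm _))// normrM ler_piMl.
    have h2 : vh (enum_val k) 0 * b0 (enum_val k) 0 <=
        vbar k 0 * `|b0 (enum_val k) 0|.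
      by rewrite (le_trans (ler_norm _))// normrM ler_wpM2r.
    by move=> h3; apply/eqP; rewrite eq_le h1; lra.
  rewrite zetaE//; case/andP: (vh_bnd k) => u1 u2; have := vbar_lt1 k.
  move=> u3 u4.
  have s0 : 1 + vh (enum_val k) 0 * Num.sg (b' (enum_val k) 0) != 0.
    by rewrite gt_eqF//; case: (sg_b' k bk) => ->; lra.
  apply: (mulfI s0); rewrite u4.
  by case: (sg_b' k bk) => ->; ring.
have nb0 : norm2 (X *m b0) ^+ 2 = m by rewrite norm2_sqr Xb0 dotX qb' mulr1.
have nb0_gt0 : 0 < norm2 (X *m b0) by exact: Xb_gt0.
have bstar_gt0 : 0 < norm2 (X *m bstar) by rewrite (lt_le_trans nb0_gt0)// Xb_le.
split=> //.
pose u := invmx (gram X S) *m (xsub X S)^T *m e.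
pose delta := embed R S *m u - (lambda / m) *: b0.
have Xdelta : X *m delta = colproj X S *m e - (lambda / m) *: (X *m b0).
  by rewrite mulmxBr -scalemxAr mulmxA -xsub_embed /u !mulmxA.
have deltaE j : delta j 0 = (embed R S *m u) j 0 - lambda / m * b0 j 0.
  by rewrite !mxE.
exists (beta0 + delta); last first.
  rewrite addrAC subrr add0r Xdelta lerBlDr.
  have nM (a : R) (c : 'cV[R]_n) : 0 <= a -> norm2 (a *: c) = a * norm2 c.
    move=> a0; apply/eqP; rewrite -(@eqrXn2 _ 2) ?norm2_ge0 ?mulr_ge0 ?norm2_ge0//.
    by rewrite exprMn !norm2_sqr dotvZl dotvZr mulrA expr2.
  have nN (c : 'cV[R]_n) : norm2 (- c) = norm2 c.
    by rewrite /norm2; congr Num.sqrt; apply: eq_bigr => i _; rewrite mxE sqrrN.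
  apply: (@le_trans _ _ (norm2 ((lambda / m) *: (X *m b0)))).
    rewrite nM ?(ltW (divr_gt0 lam0 m0))// -{1}nb0 expr2 invfM mulrA.
    rewrite mulrVK ?unitfE ?gt_eqF//.
    by rewrite ler_pM2l// lef_pV2 ?posrE// Xb_le.
  move: ((lambda / m) *: (X *m b0)) (colproj X S *m e) => Yv Pv.
  have -> : Yv = - (Pv - Yv) + Pv by rewrite opprB subrK.
  by rewrite (le_trans (norm2_triangle _ _))// nN opprB subrK.
have addE j : (beta0 + delta) j 0 = beta0 j 0 + delta j 0 by rewrite mxE.
(* The error at [j] is at most lambda (|b0_j| / m + ubar_k) < |beta0_j|, so the sign of [beta0]
   survives. *)
have betahS (k : 'I_#|S|) : let j := enum_val k in
    z j 0 * (beta0 + delta) j 0 = `|(beta0 + delta) j 0|.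
  move=> j; have [lt_beta _] := betamin k.
  have [+ _] := bbound_lt lam0 Ww lt_beta; rewrite -/b0 nb0 vsubE -/j.
  have dj : `|delta j 0| <= lambda * (`|b0 j 0| / m + ubar k 0).
    rewrite deltaE embed_val (le_trans (ler_normB _ _))// mulrDr addrC lerD//.
    by rewrite normrM gtr0_norm ?divr_gt0// mulrAC mulrA.
  move=> /(le_lt_trans dj); rewrite addE [z j 0]mxE => lt_dj.
  have := inS j; rewrite enum_in => /esym; move: lt_dj.
  case: sgrP => // [bj|bj]; rewrite ltr_norml => /andP[h1 h2] _.
  - by rewrite mul1r ger0_norm//; lra.
  - by rewrite mulN1r ler0_norm//; lra.
(* In the KKT equation lambda q cancels the bias - (lambda / m) X^T X b0, and lambda vh supplies the
   part of X^T e missed by the projection. *)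
exists (q + vh).
  rewrite addrAC subrr add0r -mulmxA Xdelta Xb0 mulmxBr -scalemxAr Hb' scalerA.
  rewrite divfK ?gt_eqF// scalerDr addrA subrK /vh scalerA divff ?gt_eqF//.
  by rewrite scale1r -mulmxDr mulmxBl mul1mx addrC subrK.
have zetaS j : j \in S -> (q + vh) j 0 = z j 0.
  by move=> jS; rewrite mxE qS// vhS// addr0.
have zetaC j : j \notin S -> (q + vh) j 0 = - zeta j 0.
  by move=> jS; have [qj _ _] := qC _ jS; rewrite mxE qj; ring.
split.
  rewrite -/(dotv _ _) dotvE /norm1; apply: eq_bigr => j _.
  have [/[dup] jS /exists_enum_val[k jk]|jS] := boolP (j \in S).
    by rewrite zetaS// jk betahS.
  have [k jk] : exists k : 'I_#|~: S|, j = enum_val k.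
    by apply: exists_enum_val; rewrite finset.in_setC.
  have /eqP bj0 : beta0 j 0 == 0 by move: jS; rewrite inS negbK.
  rewrite zetaC// addE bj0 add0r deltaE embed_out// sub0r mulrNN.
  rewrite normrN normrM gtr0_norm ?divr_gt0// mulrCA jk.
  by rewrite zeta_b0.
apply: mx_norm_le => // j.
have [jS|jS] := boolP (j \in S); last by rewrite zetaC// normrN; case: (qC _ jS).
by rewrite zetaS// mxE normr_sg; case: (_ == 0).
Qed.

(** * Orthonormal factors *)

(** The first row and column are eliminated and the factor of the Schur complement is bordered. The
    complement is positive because [G] is tested on vectors (a, y) whose [a] annihilates the first
    block of the image. *)
Lemma cholesky (R : realType) (m : nat) (G : 'M[R]_m) :
  G^T = G -> (forall x : 'cV_m, x != 0 -> 0 < dotv x (G *m x)) ->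
  exists C : 'M[R]_m, C^T *m C = G.
Proof.
elim: m G => [|m IHm] G Gsym Gpos.
  by exists 0; apply/matrixP => -[].
move: G Gsym Gpos; rewrite -[m.+1]/(1 + m)%N => G Gsym Gpos.
pose g := ulsubmx G 0 0; pose v := ursubmx G; pose H := drsubmx G.
have ulE : ulsubmx G = g%:M by rewrite [LHS]mx11_scalar.
have dlE : dlsubmx G = v^T by rewrite /v trmx_ursub Gsym.
have GE : G = block_mx g%:M v v^T H by rewrite -ulE -dlE submxK.
have HT : H^T = H by rewrite /H trmx_drsub Gsym.
have mulG (a : R) (y : 'cV[R]_m) : G *m col_mx a%:M y =
    col_mx ((g * a)%:M + v *m y) (a *: v^T + H *m y).
  by rewrite GE mul_block_col -scalar_mxM mul_mx_scalar.
have g0 : 0 < g.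
  have e0 : col_mx 1%:M 0 != 0 :> 'cV[R]_(1 + m).
    apply/eqP => /matrixP/(_ (lshift m 0) 0); rewrite col_mxEu !mxE /=.
    by move/eqP; rewrite oner_eq0.
  have := Gpos _ e0; rewrite mulG /dotv tr_col_mx mul_row_col trmx0 mul0mx addr0.
  by rewrite mulmx0 addr0 mulr1 tr_scalar_mx mul1mx mxE mulr1n.
have [C CC] : exists C : 'M[R]_m, C^T *m C = H - g^-1 *: (v^T *m v).
  apply: IHm.
    by rewrite linearB /= linearZ /= trmx_mul trmxK HT.
  move=> y y0; pose a := - (g^-1 * (v *m y) 0 0).
  have x0 : col_mx a%:M y != 0 :> 'cV[R]_(1 + m).
    apply: contra y0 => /eqP xy0; apply/eqP.
    by rewrite -[y](col_mxKd (a%:M : 'cV_1)) xy0 linear0.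
  have := Gpos _ x0; rewrite mulG.
  have -> : (g * a)%:M + v *m y = 0.
    by rewrite [v *m y]mx11_scalar -raddfD /= /a mulrN mulVKf ?gt_eqF// addNr raddf0.
  rewrite /dotv tr_col_mx mul_row_col mulmx0 add0r.
  suff -> : a *: v^T + H *m y = (H - g^-1 *: (v^T *m v)) *m y by [].
  rewrite mulmxBl addrC -scalemxAl -mulmxA [v *m y in RHS]mx11_scalar.
  by rewrite mul_mx_scalar scalerA -scaleNr.
pose s := Num.sqrt g.
have s0 : s != 0 by rewrite gt_eqF// sqrtr_gt0.
have ss : s * s = g by rewrite -expr2 sqr_sqrtr// ltW.
exists (block_mx s%:M (s^-1 *: v) 0 C).
rewrite tr_block_mx mulmx_block GE !trmx0 !mul0mx !mulmx0 !addr0 CC.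
rewrite tr_scalar_mx -scalar_mxM ss [(s^-1 *: v)^T]linearZ /=.
rewrite !mul_scalar_mx !mul_mx_scalar.
rewrite !scalerA mulfV// !scale1r; congr block_mx.
by rewrite -scalemxAl -scalemxAr scalerA -invfM ss addrC subrK.
Qed.

(** With C^T C = A^T A, the columns of U = A C^-1 are orthonormal. This replaces the projected noise
    by [m] standardized coordinates, to which the chi-square bound applies. *)
Lemma orthonormal_factor (R : realType) (n m : nat) (A : 'M[R]_(n, m)) :
  A^T *m A \in unitmx ->
  exists2 U : 'M[R]_(n, m), U^T *m U = 1%:M &
    A *m invmx (A^T *m A) *m A^T = U *m U^T.
Proof.
move=> Au; set G := A^T *m A.
have [||C CC] := @cholesky _ _ G.
- by rewrite /G trmx_mul trmxK.
- move=> x x0; rewrite /G -mulmxA -dotv_mulmx lt0r dotvv_ge0 andbT.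
  apply: contra x0 => /eqP/dotvv_eq0 Ax0.
  by rewrite -[x]mul1mx -(mulVmx Au) -!mulmxA Ax0 !mulmx0.
have Cu : C \in unitmx by move: Au; rewrite -/G -CC unitmx_mul => /andP[].
have CTu : C^T \in unitmx by rewrite unitmx_tr.
exists (A *m invmx C).
  rewrite trmx_mul mulmxA -(mulmxA _ A^T) -/G -CC trmx_inv.
  by rewrite mulmxA mulVmx// mul1mx mulmxV.
have invG : invmx G = invmx C *m invmx C^T.
  have E : invmx C *m invmx C^T *m G = 1%:M.
    by rewrite -CC mulmxA -(mulmxA (invmx C)) mulVmx// mulmx1 mulVmx.
  by rewrite -[LHS]mul1mx -E -mulmxA mulmxV// mulmx1.
by rewrite invG trmx_mul trmx_inv !mulmxA.
Qed.

(** * Gaussian integrals and tails *)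

Section LayerCake.
Local Open Scope ereal_scope.
Context {R : realType} {d : measure_display} {T : measurableType d}.

Local Notation leb := (@lebesgue_measure R).
Let GR := measurableTypeR R.

(* Layer cake: [f z] is the integral over [y] of the indicator of
   [0 <= y < f z], so by Tonelli it suffices to test against indicators. *)
Lemma ge0_integral_comp_indic (mu : {sigma_finite_measure set T -> \bar R})
    (nu : {sigma_finite_measure set GR -> \bar R}) (G : T -> \bar R) (Z : T -> R)
    (C : \bar R) (f : R -> R) :
  measurable_fun setT G -> (forall w, 0 <= G w) -> measurable_fun setT Z ->
  0 <= C -> measurable_fun setT f -> (forall z, (0 <= f z)%R) ->
  (forall B, measurable B ->
     \int[mu]_w (G w * (\1_B (Z w))%:E) = C * nu B) ->
  \int[mu]_w (G w * (f (Z w))%:E) = C * \int[nu]_z (f z)%:E.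
Proof.
move=> mG G0 mZ C0 mf f0 indicE.
pose b (y z : R) := ((0 <= y) && (y < f z))%R.
pose B (y : R) : set R := [set z | b y z].
have layer z : (f z)%:E = \int[leb]_y (b y z)%:R%:E.
  transitivity (leb `[0%R, f z[%classic).
    rewrite lebesgue_measure_itv/= lte_fin.
    by case: ltP => [_|fz]; [rewrite oppr0 adde0|congr EFin; apply/le_anti/andP].
  have mI : measurable (`[0%R, f z[%classic : set R) by [].
  transitivity (\int[leb]_y (\1_(`[0%R, f z[%classic) y)%:E).
    by rewrite integral_indic// setIT.
  apply: eq_integral => y _; rewrite numfun.indicE.
  by congr ((nat_of_bool _)%:R%:E); apply/idP/idP; rewrite inE /= in_itv.
have mb d' (T' : measurableType d') (Y W : T' -> R) :
    measurable_fun setT Y -> measurable_fun setT W ->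
    measurable_fun setT (fun x => (b (Y x) (W x))%:R%:E : \bar R).
  move=> mY mW; apply/measurable_EFinP/measurableT_comp => //.
  apply: measurable_and; first exact: measurable_fun_ler.
  by apply: measurable_fun_ltr => //; exact: measurableT_comp.
have b0 y z : 0 <= (b y z)%:R%:E :> \bar R by rewrite lee_fin ler0n.
have indicB y z : (\1_(B y) z)%:E = (b y z)%:R%:E :> \bar R.
  rewrite numfun.indicE; congr ((nat_of_bool _)%:R%:E).
  by apply/idP/idP; rewrite inE.
have mB y : measurable (B y).
  apply/(measurable_indicP R)/measurable_EFinP.
  apply: (eq_measurable_fun (fun z => (b y z)%:R%:E)); last exact: mb.
  by move=> z _ /=; rewrite indicB.
transitivity (\int[mu]_w \int[leb]_y (G w * (b y (Z w))%:R%:E)).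
  apply: eq_integral => w _; rewrite layer ge0_integralZl//.
  exact: mb.
transitivity (\int[leb]_y \int[mu]_w (G w * (b y (Z w))%:R%:E)).
  apply: (fubini_tonelli (fun wy : T * GR => G wy.1 * (b wy.2 (Z wy.1))%:R%:E)).
    apply: emeasurable_funM; first exact: measurableT_comp.
    by apply: mb => //; exact: measurableT_comp.
  by move=> wy; rewrite mule_ge0.
transitivity (\int[leb]_y (C * \int[nu]_z (b y z)%:R%:E)).
  apply: eq_integral => y _; under eq_integral do rewrite -indicB.
  rewrite indicE//; congr (_ * _).
  by under eq_integral do rewrite -indicB;
    rewrite (integral_indic nu measurableT (mB y)) setIT.
rewrite ge0_integralZl//; last 2 first.
- have := measurable_fun_fubini_tonelli_F (m2 := nu)
    (fun yz : GR * GR => (b yz.1 yz.2)%:R%:E).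
  by apply => //; exact: mb.
- by move=> y _; exact: integral_ge0.
congr (_ * _).
transitivity (\int[nu]_z \int[leb]_y (b y z)%:R%:E).
  by apply: (fubini_tonelli (fun yz : GR * GR => (b yz.1 yz.2)%:R%:E)) => //;
    exact: mb.
by apply: eq_integral => z _; rewrite layer.
Qed.

End LayerCake.

Section NormalIntegrals.
Local Open Scope ereal_scope.
Context {R : realType}.
Let N := normal_prob (0 : R) 1.

Lemma ge0_integral_normal_prob (f : R -> R) :
  measurable_fun setT f -> (forall z, (0 <= f z)%R) ->
  \int[N]_z (f z)%:E = \int[lebesgue_measure]_z (normal_pdf 0 1 z * f z)%:E.
Proof.
move=> mf f0; rewrite -[LHS]mul1e.
under [RHS]eq_integral do rewrite EFinM.
symmetry; apply: (ge0_integral_comp_indic (mu := lebesgue_measure)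
  (nu := normal_prob (0 : R) 1) (G := fun z => (normal_pdf 0 1 z)%:E)
  (Z := id)) => //.
- by apply/measurable_EFinP; exact: measurable_normal_pdf.
- by move=> z; rewrite lee_fin normal_pdf_ge0.
move=> B mB; rewrite mul1e /normal_prob /= [RHS]integral_mkcond.
apply: eq_integral => z _; rewrite patchE numfun.indicE.
by case: ifP; rewrite ?mule1 ?mule0.
Qed.

(** Completing the square: the exponential turns the standard density into expR (h^2 / 2) times the
    density centred at [h]. *)
Lemma integral_normal_expR (h : R) :
  \int[N]_z (expR (h * z))%:E = (expR (h ^+ 2 / 2))%:E.
Proof.
rewrite ge0_integral_normal_prob//; last first.
  by apply: measurableT_comp => //; exact: measurable_funM.
transitivity (\int[lebesgue_measure]_z
    ((expR (h ^+ 2 / 2))%:E * (normal_pdf h 1 z)%:E)).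
  apply: eq_integral => z _; rewrite -EFinM; congr EFin.
  rewrite !normal_pdfE ?oner_eq0// /normal_fun.
  rewrite mulrCA -mulrA -!expRD; congr (_ * expR _)%R.
  by rewrite expr1n; field.
rewrite ge0_integralZl//; first by rewrite integral_normal_pdf mule1.
- by apply/measurable_EFinP; exact: measurable_normal_pdf.
- by move=> z _; rewrite lee_fin normal_pdf_ge0.
Qed.

(** The exponential turns the standard density into [rho] times the centred density of standard
    deviation [rho]. *)
Lemma integral_normal_expR_sqr (rho : R) : (0 < rho)%R ->
  \int[N]_z (expR ((1 - rho ^- 2) / 2 * z ^+ 2))%:E = rho%:E.
Proof.
move=> rho0; rewrite ge0_integral_normal_prob//; last first.
  by apply: measurableT_comp => //; apply: measurable_funM.
transitivity (\int[lebesgue_measure]_z (rho%:E * (normal_pdf 0 rho z)%:E)).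
  apply: eq_integral => z _; rewrite -EFinM; congr EFin.
  rewrite !normal_pdfE ?oner_eq0 ?gt_eqF// /normal_fun.
  rewrite -[LHS]mulrA -expRD [RHS]mulrA; congr (_ * expR _)%R; last first.
    by rewrite subr0; field; rewrite gt_eqF.
  rewrite /normal_peak -!mulrnAr (sqrtrM _ (sqr_ge0 1)) (sqrtrM _ (sqr_ge0 rho)).
  rewrite !sqrtr_sqr normr1.
  by rewrite mul1r gtr0_norm// invfM mulVKf ?gt_eqF.
rewrite ge0_integralZl//; first by rewrite integral_normal_pdf mule1.
- by apply/measurable_EFinP; exact: measurable_normal_pdf.
- by move=> z _; rewrite lee_fin normal_pdf_ge0.
- by rewrite lee_fin ltW.
Qed.

End NormalIntegrals.

Section GaussianVectors.
Local Open Scope ereal_scope.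
Context {R : realType} {d : measure_display} {T : measurableType d}.
Context {P : probability T R}.
Local Notation N := (normal_prob (0 : R) 1).

Lemma prod_EFin (I : finType) (A : pred I) (f : I -> R) :
  \prod_(i | A i) (f i)%:E = (\prod_(i | A i) f i)%R%:E.
Proof. by rewrite (big_morph EFin (@EFinM R) erefl). Qed.

Lemma measurable_prod_cond (I : finType) (A : pred I) (f : I -> T -> R) :
  (forall i, measurable_fun setT (f i)) ->
  measurable_fun setT (fun w => \prod_(i | A i) f i w)%R.
Proof.
move=> mf; under eq_fun do rewrite -big_filter.
by apply: measurable_prod => i _; exact: mf.
Qed.

(* Starting from indicators, where this is the definition of independence, the
   factors are replaced by arbitrary functions one coordinate at a time. *)
Lemma integral_prod_iid_normal (n : nat) (eps : 'I_n -> {RV P >-> R})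
    (g : 'I_n -> R -> R) :
  iid_std_gaussian eps -> (forall i, measurable_fun setT (g i)) ->
  (forall i z, (0 <= g i z)%R) ->
  \int[P]_w (\prod_i g i (eps i w))%R%:E = \prod_i \int[N]_z (g i z)%:E.
Proof.
move=> [indep gauss] mg g0.
suff main k (s : {set 'I_n}) : (#|s| <= k)%N ->
    forall g : 'I_n -> R -> R, (forall i, measurable_fun setT (g i)) ->
    (forall i z, (0 <= g i z)%R) ->
    (forall i, i \notin s -> exists2 B : set R, measurable B & g i = \1_B) ->
    \int[P]_w (\prod_i g i (eps i w))%R%:E = \prod_i \int[N]_z (g i z)%:E.
  by apply: (main _ finset.setT (leqnn _)) => // i; rewrite inE.
elim: k s => [|k IHk] s sk {}g {}mg {}g0 gs.
  have /choice[B HB] : forall i, exists B : set R, measurable B /\ g i = \1_B.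
    move=> i; have [|B mB gB] := gs i; last by exists B.
    by move: sk; rewrite leqn0 cards_eq0 => /eqP ->; rewrite inE.
  have mB i : measurable (B i) by case: (HB i).
  have gB i z : g i z = \1_(B i) z by case: (HB i) => _ ->.
  (* All factors are now indicators, so their product is the indicator of [E]. *)
  pose E := \bigcap_(i in [set` [set: 'I_n]%SET]) eps i @^-1` B i.
  have mE : measurable E.
    apply: fin_bigcap_measurable => // i _.
    by rewrite -[X in measurable X]setTI; exact: measurable_funP.
  transitivity (\int[P]_w (\1_E w)%:E).
    apply: eq_integral => w _; congr EFin.
    under eq_bigr do rewrite gB numfun.indicE.
    rewrite numfun.indicE; case: (boolP (w \in E)).
      rewrite inE => wE; rewrite big1// => i _; rewrite mem_set//.
      by apply: (wE i); rewrite /= inE.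
    rewrite notin_setE => nwE.
    have [i Hi] : exists i, ~ B i (eps i w).
      by apply/existsNP => wB; apply: nwE => i _; exact: wB.
    by rewrite (bigD1 i)//= memNset// mul0r.
  transitivity (P E); first by rewrite integral_indic// setIT.
  rewrite [LHS](indep finset.setT B mB).
  apply: eq_big => [i|i _]; first by rewrite inE.
  under eq_integral do rewrite gB.
  rewrite (integral_indic N measurableT (mB i)) setIT.
  exact: (gauss i (B i) (mB i)).
have [s0|[i is_]] := set_0Vmem s.
  by apply: (IHk s) => //; rewrite s0 cards0.
pose G w := (\prod_(j | j != i) g j (eps j w))%R%:E : \bar R.
transitivity (\int[P]_w (G w * (g i (eps i w))%:E)).
  by apply: eq_integral => w _; rewrite (bigD1 i)//= mulrC EFinM.
transitivity ((\prod_(j | j != i) \int[N]_z (g j z)%:E) * \int[N]_z (g i z)%:E);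
  last by rewrite [RHS](bigD1 i)//= muleC.
apply: (ge0_integral_comp_indic (mu := P) (nu := N) (G := G) (Z := eps i)) => //.
- by apply/measurable_EFinP/measurable_prod_cond => j; exact: measurableT_comp.
- by move=> w; rewrite lee_fin prodr_ge0.
- by apply: prode_ge0 => j _; apply: integral_ge0 => z _; rewrite lee_fin.
move=> B mB.
(* Testing against [B] turns factor [i] into an indicator, so [i] leaves [s] and the induction
   hypothesis applies. *)
pose g' j := if j == i then \1_B else g j.
transitivity (\int[P]_w (\prod_j g' j (eps j w))%R%:E).
  apply: eq_integral => w _; rewrite (bigD1 i)//= {1}/g' eqxx mulrC EFinM.
  by congr (_%:E * _); apply: eq_bigr => j /negPf ji; rewrite /g' ji.
rewrite (IHk (s :\ i)).
- rewrite (bigD1 i)//= muleC; congr (_ * _).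
    by apply: eq_bigr => j /negPf ji; rewrite /g' ji.
  by rewrite /g' eqxx (integral_indic N measurableT mB) setIT.
- by move: sk; rewrite (cardsD1 i) is_.
- by move=> j; rewrite /g'; case: eqP => // _; exact: measurable_indic.
- by move=> j z; rewrite /g'; case: eqP => // _; rewrite numfun.indicE ler0n.
move=> j; rewrite !inE negb_and negbK /g'; case: eqP => [_ _|_ /= js].
  by exists B.
exact: gs.
Qed.

Lemma measurable_le_set (f g : T -> R) :
  measurable_fun setT f -> measurable_fun setT g ->
  measurable [set w | (f w <= g w)%R].
Proof.
by move=> mf mg; rewrite -[X in measurable X]setTI; exact: measurable_fun_le.
Qed.

Lemma measurable_lt_set (f g : T -> R) :
  measurable_fun setT f -> measurable_fun setT g ->
  measurable [set w | (f w < g w)%R].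
Proof.
move=> mf mg; rewrite (_ : [set w | _] = ~` [set w | (g w <= f w)%R]).
  by apply: measurableC; exact: measurable_le_set.
by apply/seteqP; split=> w /=; rewrite ltNge => /negP.
Qed.

Section Eps.
Context {n : nat} {eps : 'I_n -> {RV P >-> R}} (iid : iid_std_gaussian eps).
Local Notation epsv := (fun w => \col_i eps i w).

Lemma measurable_dotv (c : 'cV[R]_n) :
  measurable_fun setT (fun w => dotv c (epsv w)).
Proof.
under eq_fun do rewrite dotvE.
apply: measurable_sum => i; apply: measurable_funM => //.
by apply: (eq_measurable_fun (eps i)) => // w _; rewrite mxE.
Qed.

Lemma integral_expR_dotv (c : 'cV[R]_n) :
  \int[P]_w (expR (dotv c (epsv w)))%:E = (expR (dotv c c / 2))%:E.
Proof.
transitivity (\int[P]_w (\prod_i expR (c i 0%R * eps i w))%R%:E).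
  apply: eq_integral => w _; rewrite dotvE expR_sum.
  by under eq_bigr do rewrite mxE.
rewrite (integral_prod_iid_normal (g := fun i z => expR (c i 0%R * z)%R))//.
  under eq_bigr do rewrite integral_normal_expR.
  rewrite prod_EFin -expR_sum dotvE mulr_suml.
  by under eq_bigr do rewrite expr2.
by move=> i; apply: measurableT_comp => //; exact: measurable_funM.
Qed.

Lemma chernoff_le (X : T -> R) (a m : R) : measurable_fun setT X ->
  \int[P]_w (expR (X w))%:E <= m%:E ->
  P [set w | (a <= X w)%R] <= (m * expR (- a))%:E.
Proof.
move=> mX le_m.
have mE : measurable_fun setT (fun w => (expR (X w))%:E).
  by apply/measurable_EFinP; exact: measurableT_comp.
have := le_integral_abse P measurableT mE (expR_gt0 a); rewrite setTI.
have -> : [set w | (expR a)%:E <= `|(expR (X w))%:E|] = [set w | (a <= X w)%R].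
  by apply/seteqP; split=> w /=; rewrite ger0_norm ?expR_ge0// lee_fin ler_expR.
under eq_integral do rewrite gee0_abs ?lee_fin ?expR_ge0//.
move=> /le_trans/(_ le_m); rewrite expRN EFinM.
by rewrite -lee_pdivlMl ?expR_gt0// muleC.
Qed.

Lemma gaussian_tail (c : 'cV[R]_n) (r : R) : (0 <= r)%R ->
  P [set w | (r * norm2 c < `|dotv c (epsv w)|)%R]
    <= (2 * expR (- (r ^+ 2 / 2)))%:E.
Proof.
move=> r0.
have [c0|c0] := eqVneq (norm2 c) 0%R.
  rewrite [X in P X](_ : _ = set0).
    by rewrite measure0 lee_fin mulr_ge0// expR_ge0.
  apply/seteqP; split=> w //=.
  have /dotvv_eq0 -> : dotv c c = 0%R by rewrite -norm2_sqr c0 expr0n.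
  by rewrite dotv0l normr0 ltNge mulr_ge0 ?norm2_ge0.
have nc0 : (0 < norm2 c)%R by rewrite lt0r c0 norm2_ge0.
(* The optimal Chernoff parameter: after scaling, the threshold and the variance are both r^2, and
   the exponent is r^2 / 2 - r^2. The two signs of [l] account for the absolute value. *)
pose l := (r / norm2 c)%R.
have tail (b : 'cV[R]_n) : dotv b b = (r ^+ 2)%R ->
    P [set w | (r ^+ 2 <= dotv b (epsv w))%R] <= (expR (- (r ^+ 2 / 2)))%:E.
  move=> bb; have := @chernoff_le _ (r ^+ 2) (expR (r ^+ 2 / 2))
    (measurable_dotv b).
  rewrite -expRD integral_expR_dotv bb => /(_ (lexx _)) /le_trans; apply.
  by rewrite lee_fin ler_expR; lra.
have lsqr : (l ^+ 2 * dotv c c = r ^+ 2)%R.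
  by rewrite -norm2_sqr -exprMn divfK.
have mA (b : 'cV[R]_n) : measurable [set w | (r ^+ 2 <= dotv b (epsv w))%R].
  by apply: measurable_le_set => //; exact: measurable_dotv.
apply: (@le_trans _ _ (P ([set w | (r ^+ 2 <= dotv (l *: c) (epsv w))%R] `|`
   [set w | (r ^+ 2 <= dotv (- l *: c) (epsv w))%R]))).
  apply: le_measure; rewrite ?inE//; [|exact: measurableU|].
    apply: measurable_lt_set => //.
    by apply: measurableT_comp => //; exact: measurable_dotv.
  move=> w /=; rewrite !dotvZl.
  have -> : (r ^+ 2 = l * (r * norm2 c))%R by rewrite /l; field.
  have l0 : (0 <= l)%R by rewrite divr_ge0// ltW.
  move=> /ltW; rewrite ler_normr => /orP[h|h]; [left|right].
    exact: ler_wpM2l.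
  by rewrite mulNr -mulrN; exact: ler_wpM2l.
apply: (le_trans (measureU2 _ _ _)) => //.
rewrite mulr2n mulrDl mul1r EFinD.
by apply: leeD; apply: tail; rewrite dotvZl dotvZr mulrA -expr2 ?sqrrN.
Qed.
End Eps.
End GaussianVectors.

(** * Chi-square moments and tail *)

Section ChiSquare.
Local Open Scope ereal_scope.
Context {R : realType} {d : measure_display} {T : measurableType d}.
Context {P : probability T R}.
Local Notation N := (normal_prob (0 : R) 1).
Let GR := measurableTypeR R.

(* [expR (a^2 z^2 / 2)] is the mean of [expR (a y z)] over a standard normal
   [y], which linearizes the square. *)
Lemma ge0_integral_expR_sqr (G : T -> \bar R) (Z : T -> R) (C : \bar R) rho :
  measurable_fun setT G -> (forall w, 0 <= G w) -> measurable_fun setT Z ->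
  0 <= C -> (1 <= rho)%R ->
  (forall h, \int[P]_w (G w * (expR (h * Z w))%:E) =
     C * (expR (h ^+ 2 / 2))%:E) ->
  \int[P]_w (G w * (expR ((1 - rho ^- 2) / 2 * Z w ^+ 2))%:E) = C * rho%:E.
Proof.
move=> mG G0 mZ C0 rho1 mgf.
have rho0 : (0 < rho)%R by exact: lt_le_trans rho1.
pose a := Num.sqrt (1 - rho ^- 2).
have a2 : (a ^+ 2 = 1 - rho ^- 2)%R.
  by rewrite sqr_sqrtr// subr_ge0 invf_le1 ?exprn_gt0// exprn_ege1.
have sqrE y : (expR ((1 - rho ^- 2) / 2 * y ^+ 2)) =
    (expR ((a * y) ^+ 2 / 2)).
  by rewrite exprMn a2; congr expR; ring.
have mlin k : measurable_fun setT (fun y : R => (expR (k * y))%:E).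
  by apply/measurable_EFinP; apply: measurableT_comp.
have msqr k : measurable_fun setT (fun y : R => (expR (k * y ^+ 2))%:E).
  apply/measurable_EFinP; apply: measurableT_comp => //.
  by apply: measurable_funM => //; exact: exprn_measurable.
transitivity (\int[P]_w \int[N]_y (G w * (expR (a * Z w * y))%:E)).
  apply: eq_integral => w _; rewrite sqrE -integral_normal_expR ge0_integralZl//.
  exact: mlin.
transitivity (\int[N]_y \int[P]_w (G w * (expR (a * Z w * y))%:E)).
  apply: (fubini_tonelli
    (fun wy : T * GR => G wy.1 * (expR (a * Z wy.1 * wy.2))%:E)).
    apply: emeasurable_funM; first exact: measurableT_comp.
    apply/measurable_EFinP; apply: measurableT_comp => //.
    apply: measurable_funM => //; apply: measurable_funM => //.
    exact: measurableT_comp.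
  by move=> wy; rewrite mule_ge0// lee_fin expR_ge0.
transitivity (\int[N]_y (C * (expR ((1 - rho ^- 2) / 2 * y ^+ 2))%:E)).
  apply: eq_integral => y _; rewrite sqrE -mgf; apply: eq_integral => w _.
  by rewrite mulrAC.
rewrite ge0_integralZl//; first by rewrite integral_normal_expR_sqr.
exact: msqr.
Qed.

Context {n : nat} {eps : 'I_n -> {RV P >-> R}} (iid : iid_std_gaussian eps).
Local Notation epsv := (fun w => \col_i eps i w).

Lemma measurable_mulmx (m : nat) (A : 'M[R]_(m, n)) k :
  measurable_fun setT (fun w => (A *m epsv w) k 0%R).
Proof.
apply: (eq_measurable_fun (fun w => dotv (row k A)^T (epsv w))) => [w _|].
  by rewrite mxE dotvE; apply: eq_bigr => i _; rewrite !mxE.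
exact: measurable_dotv.
Qed.

Lemma measurable_norm2_sqr (m : nat) (A : 'M[R]_(m, n)) :
  measurable_fun setT (fun w => norm2 (A *m epsv w) ^+ 2)%R.
Proof.
under eq_fun do rewrite norm2_sqr dotvE.
by apply: measurable_sum => k; apply: measurable_funM; exact: measurable_mulmx.
Qed.

(** Orthonormality makes the joint moment generating function of the coordinates [eta k] a product.
    Linear exponents are then traded for quadratic ones a coordinate at a time, without establishing
    independence of the [eta k]. *)
Lemma integral_expR_chi2 (m : nat) (U : 'M[R]_(n, m)) (rho : R) :
  U^T *m U = 1%:M -> (1 <= rho)%R ->
  \int[P]_w (expR ((1 - rho ^- 2) / 2 *
     norm2 (U^T *m epsv w) ^+ 2))%:E = (rho ^+ m)%:E.
Proof.
move=> UU rho1; set theta := ((1 - rho ^- 2) / 2)%R.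
have rho0 : (0 <= rho)%R by exact: le_trans rho1.
pose eta k w := (U^T *m epsv w) k 0%R.
have meta k : measurable_fun setT (eta k) by exact: measurable_mulmx.
(* Coordinates in [K] carry the quadratic exponent, the others a linear one with free coefficient
   [h k]. The induction starts at the empty [K]; the goal is the full one. *)
pose F (K : {set 'I_m}) (h : 'I_m -> R) k z :=
  expR (if k \in K then theta * z ^+ 2 else h k * z)%R.
pose C (K : {set 'I_m}) (h : 'I_m -> R) k : R :=
  if k \in K then rho else expR (h k ^+ 2 / 2).
have mF K h k : measurable_fun setT (F K h k).
  rewrite /F; case: (k \in K); apply: measurableT_comp => //.
  by apply: measurable_funM => //; exact: exprn_measurable.
suff main j (K : {set 'I_m}) h : (#|K| <= j)%N ->
    \int[P]_w (\prod_k F K h k (eta k w))%R%:E = (\prod_k C K h k)%R%:E.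
  transitivity (\int[P]_w (\prod_k F finset.setT (cst 0%R) k (eta k w))%R%:E).
    apply: eq_integral => w _; rewrite norm2_sqr dotvE mulr_sumr expR_sum.
    by congr EFin; apply: eq_bigr => k _; rewrite /F inE expr2.
  rewrite (main m) ?cardsT ?card_ord//; congr EFin.
  rewrite (eq_bigr (fun=> rho)) ?prodr_const ?card_ord// => k _.
  by rewrite /C inE.
elim: j K h => [|j IHj] K h Kj.
  have K0 : K = finset.set0 by apply/eqP; move: Kj; rewrite leqn0 cards_eq0.
  pose hv : 'cV[R]_m := \col_k h k.
  transitivity (\int[P]_w (expR (dotv (U *m hv) (epsv w)))%:E).
    apply: eq_integral => w _; rewrite dotv_mulmx dotvE expR_sum; congr EFin.
    by apply: eq_bigr => k _; rewrite /F K0 inE [hv k 0%R]mxE.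
  rewrite integral_expR_dotv// dotv_mulmx mulmxA UU mul1mx dotvE.
  rewrite mulr_suml expR_sum; congr EFin; apply: eq_bigr => k _.
  by rewrite /C K0 inE !mxE.
have [K0|[k kK]] := set_0Vmem K.
  by apply: (IHj K) => //; rewrite K0 cards0.
pose G w := (\prod_(i | i != k) F K h i (eta i w))%R%:E : \bar R.
transitivity (\int[P]_w (G w * (expR (theta * eta k w ^+ 2))%:E)).
  by apply: eq_integral => w _; rewrite (bigD1 k)//= {1}/F kK mulrC EFinM.
transitivity ((\prod_(i | i != k) C K h i)%R%:E * rho%:E);
  last by rewrite [in RHS](bigD1 k)//= [C K h k]/C kK mulrC EFinM.
apply: ge0_integral_expR_sqr => //.
- by apply/measurable_EFinP/measurable_prod_cond => i; exact: measurableT_comp.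
- by move=> w; rewrite lee_fin prodr_ge0// => i _; exact: expR_ge0.
- by rewrite lee_fin prodr_ge0// => i _; rewrite /C; case: ifP; rewrite ?expR_ge0.
(* Coordinate [k] leaves [K] and takes the arbitrary coefficient [h']. *)
move=> h'; pose h2 i := if i == k then h' else h i.
have Fk z : F (K :\ k) h2 k z = expR (h' * z) by rewrite /F !inE eqxx /h2 eqxx.
have Fi i z : i != k -> F (K :\ k) h2 i z = F K h i z.
  by move=> ik; rewrite /F !inE ik /h2 (negPf ik).
have Ck : C (K :\ k) h2 k = expR (h' ^+ 2 / 2) by rewrite /C !inE eqxx /h2 eqxx.
have Ci i : i != k -> C (K :\ k) h2 i = C K h i.
  by move=> ik; rewrite /C !inE ik /h2 (negPf ik).
transitivity (\int[P]_w (\prod_i F (K :\ k) h2 i (eta i w))%R%:E).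
  apply: eq_integral => w _; rewrite (bigD1 k)//= Fk EFinM muleC.
  by rewrite /G (eq_bigr _ (fun i ik => Fi i _ ik)).
rewrite IHj; last by move: Kj; rewrite (cardsD1 k) kK.
rewrite (bigD1 k)//= Ck EFinM muleC.
by rewrite (eq_bigr _ Ci).
Qed.

(* The exponent [(1 - rho^-2) / 2] with [rho = 1 + sqrt (2 x / m)] is the
   minimizer in Chernoff's bound; [rho <= expR (rho - 1)] does the rest. *)
Lemma chi2_tail (m : nat) (U : 'M[R]_(n, m)) (x : R) :
  (0 < m)%N -> U^T *m U = 1%:M -> (0 < x)%R ->
  P [set w | (Num.sqrt m%:R + Num.sqrt (2 * x) < norm2 (U^T *m epsv w))%R]
    <= (expR (- x))%:E.
Proof.
move=> m0 UU x0; set a := Num.sqrt m%:R; set c := Num.sqrt (2 * x).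
have a0 : (0 < a)%R by rewrite sqrtr_gt0 ltr0n.
have c0 : (0 < c)%R by rewrite sqrtr_gt0 mulr_gt0.
have a2 : (a ^+ 2 = m%:R)%R by rewrite sqr_sqrtr// ler0n.
have c2 : (c ^+ 2 = 2 * x)%R by rewrite sqr_sqrtr// mulr_ge0// ltW.
pose rho := (1 + c / a)%R.
have rho1 : (1 <= rho)%R by rewrite lerDl divr_ge0// ltW.
have rho0 : (0 < rho)%R by exact: lt_le_trans rho1.
have ac : (a + c = a * rho)%R by rewrite /rho; field; rewrite gt_eqF.
set theta := ((1 - rho ^- 2) / 2)%R.
have theta0 : (0 <= theta)%R.
  by rewrite divr_ge0// subr_ge0 invf_le1 ?exprn_gt0// exprn_ege1.
pose Q w := (norm2 (U^T *m epsv w) ^+ 2)%R.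
have mX : measurable_fun setT (fun w => (theta * Q w)%R).
  by apply: measurable_funM => //; exact: measurable_norm2_sqr.
have := @chernoff_le _ _ _ P (fun w => (theta * Q w)%R) (theta * (a + c) ^+ 2)
  (rho ^+ m) mX.
rewrite integral_expR_chi2// => /(_ (lexx _)) bound.
have ltE : [set w | (a + c < norm2 (U^T *m epsv w))%R] =
    [set w | ((a + c) ^+ 2 < Q w)%R].
  apply/seteqP; split=> w /=;
  by rewrite ltr_sqr ?nnegrE ?norm2_ge0 ?addr_ge0// ltW.
apply: (@le_trans _ _ (P [set w | (theta * (a + c) ^+ 2 <= theta * Q w)%R])).
  rewrite ltE; apply: le_measure; rewrite ?inE.
  - by apply: measurable_lt_set => //; exact: measurable_norm2_sqr.
  - exact: measurable_le_set.
  by move=> w /= /ltW; exact: ler_wpM2l.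
apply: (le_trans bound); rewrite lee_fin.
apply: (@le_trans _ _
  (expR ((rho - 1) * m%:R) * expR (- (theta * (a + c) ^+ 2)))%R).
  rewrite ler_wpM2r ?expR_ge0// expRM_natr lerXn2r ?nnegrE ?expR_ge0 ?(ltW rho0)//.
  by have := expR_ge1Dx (rho - 1); rewrite addrC subrK.
(* An equality: (rho - 1) m - m (rho^2 - 1) / 2 = - m (rho - 1)^2 / 2 = - c^2 / 2 = - x. *)
rewrite -expRD ler_expR le_eqVlt; apply/orP; left; apply/eqP.
have -> : x = (c ^+ 2 / 2)%R by rewrite c2; field.
rewrite -a2 ac exprMn /theta /rho; field.
by rewrite !gt_eqF// addr_gt0.
Qed.
End ChiSquare.

(** * Noise variances *)

(** The direction that matters, as [kappa_hat] ends up in a denominator: the minimal value bounds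
    the set from below, and the infimum is nonnegative, so the square undoes the root. *)
Lemma kappa_hat_sqr_ge (R : realType) (n p : nat) (X : 'M[R]_(n, p))
    (S : {set 'I_p}) (w : 'cV[R]_#|~: S|) (b : 'cV[R]_p) :
  is_argmin (fun c => norm2 (X *m c) ^+ 2) (compat_set w) b ->
  #|S|%:R * norm2 (X *m b) ^+ 2 / n%:R <= kappa_hat X w ^+ 2.
Proof.
move=> [bw bmin]; rewrite /kappa_hat; set E := [set _ | _ in _].
have lb : #|S|%:R * norm2 (X *m b) ^+ 2 / n%:R <= inf E.
  apply: lb_le_inf; first by exists (#|S|%:R * norm2 (X *m b) ^+ 2 / n%:R), b.
  by move=> _ [c cw <-]; rewrite ler_wpM2r ?invr_ge0// ler_wpM2l// bmin.
have E0 : 0 <= inf E.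
  by apply: le_trans lb; rewrite divr_ge0// mulr_ge0// sqr_ge0.
by rewrite (sqr_sqrtr E0).
Qed.

Lemma norm2_row (R : realType) (m n : nat) (A : 'M[R]_(m, n)) k :
  norm2 (row k A)^T = Num.sqrt ((A *m A^T) k k).
Proof.
rewrite /norm2 mxE; congr Num.sqrt; apply: eq_bigr => i _.
by rewrite !mxE expr2.
Qed.

Lemma mulmx_row_dotv (R : realType) (m n : nat) (A : 'M[R]_(m, n)) u k :
  (A *m u) k 0 = dotv (row k A)^T u.
Proof. by rewrite mxE dotvE; apply: eq_bigr => i _; rewrite !mxE. Qed.

Section NoiseVariances.
Context {R : realType} {n p : nat} (X : 'M[R]_(n, p)) (S : {set 'I_p}).
Hypothesis Gu : gram X S \in unitmx.

Let GT : (gram X S)^T = gram X S.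
Proof. by rewrite /gram trmx_mul trmxK. Qed.

Lemma colproj_sym : (colproj X S)^T = colproj X S.
Proof. by rewrite /colproj !trmx_mul trmxK trmx_inv GT mulmxA. Qed.

Lemma colproj_idem : colproj X S *m colproj X S = colproj X S.
Proof. by rewrite {1}/colproj -!mulmxA (xsub_proj Gu) !mulmxA. Qed.

(** The standard deviation of a residual correlation is the length of its row; idempotence of the
    projection reduces the squared length to a diagonal entry of [resid_gram]. *)
Lemma norm2_row_resid k :
  norm2 (row k ((xsub X (~: S))^T *m (1%:M - colproj X S)))^T = vvec X S k 0.
Proof.
rewrite norm2_row [RHS]mxE; congr (Num.sqrt (fun_of_matrix _ k k)).
rewrite trmx_mul trmxK [(_ - _)^T]linearB /= trmx1 colproj_sym /resid_gram.
rewrite -/(colproj X S).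
rewrite !mulmxA -(mulmxA _ (1%:M - _) (1%:M - _)); congr (_ *m _ *m _).
by rewrite mulmxBr mulmx1 mulmxBl mul1mx colproj_idem subrr subr0.
Qed.

Lemma norm2_row_invgram k :
  norm2 (row k (invmx (gram X S) *m (xsub X S)^T))^T = uvec X S k 0.
Proof.
rewrite norm2_row [RHS]mxE; congr (Num.sqrt (fun_of_matrix _ k k)).
rewrite trmx_mul trmxK trmx_inv GT mulmxA -(mulmxA (invmx _)) -/(gram X S).
by rewrite mulVmx// mul1mx.
Qed.

End NoiseVariances.

Lemma measure_bigcup_fin_le (R : realType) (d : measure_display)
    (T : measurableType d) (P : {measure set T -> \bar R}) (I : finType)
    (F : I -> set T) (q : R) :
  (forall i, measurable (F i)) -> (forall i, P (F i) <= q%:E)%E ->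
  measurable (\bigcup_i F i) /\ (P (\bigcup_i F i) <= (q *+ #|I|)%:E)%E.
Proof.
move=> mF Fq.
have -> : \bigcup_i F i = \big[setU/set0]_(i <- enum I) F i.
  rewrite -bigcup_seq; apply/seteqP; split=> w [i _ Fi]; exists i => //=.
  by rewrite mem_enum.
rewrite cardE; elim: (enum I) => [|i s [ms Ps]].
  by rewrite big_nil /= measure0 mulr0n; split.
rewrite big_cons; split; first exact: measurableU.
by apply: (le_trans (measureU2 _ _ _)) => //; rewrite /= mulrS EFinD leeD.
Qed.

(** * The good event and the conclusion *)

Unset Implicit Arguments.

Theorem theorem7p1 (R : realType) (d : measure_display) (T : measurableType d)
  (P : probability T R) (n p : nat) (X : 'M[R]_(n, p)) (beta0 : 'cV[R]_p)
  (eps : 'I_n -> {RV P >-> R}) (Y : T -> 'cV[R]_n) (lambda t : R)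
  (bstar : 'cV[R]_p)
  (b : 'cV[R]_#|~: active_set beta0| -> 'cV[R]_p) :
  let S0 := active_set beta0 in
  let s0 := #|S0| in
  let epsv := fun omega => \col_i eps i omega in
  let r := Num.sqrt (2 * (ln (2 * p%:R) + t)) in
  let vbar := (r / lambda) *: vvec X S0 in
  let ubar := (r / lambda) *: uvec X S0 in
  let zstar := \col_k Num.sg (vsub bstar S0 k 0) in
  let kappa := kappa_hat X (const_mx 1 + vbar) in
  (0 < s0)%N ->
  gram X S0 \in unitmx ->
  iid_std_gaussian eps ->
  (forall omega, Y omega = X *m beta0 + epsv omega) ->
  0 < t ->
  `|vvec X S0| * r < lambda ->
  is_argmin (fun c => norm2 (X *m c) ^+ 2)
    (compat_set (const_mx 1 + vbar)) bstar ->
  (forall w, weight_set vbar w ->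
     is_argmin (fun c => norm2 (X *m c) ^+ 2) (sign_set zstar w) (b w)) ->
  0 < kappa ->
  (forall k : 'I_s0,
     (lambda%:E * (bbound X vbar b k + (ubar k 0)%:E)
        < `|vsub beta0 S0 k 0|%:E)%E /\
     Num.sg (vsub beta0 S0 k 0) = zstar k 0) ->
  forall x : R, 0 < x ->
  exists A : set T,
    [/\ measurable A,
        ((1 - expR (- t) - expR (- x))%:E <= P A)%E &
        forall omega, A omega ->
          exists2 betah : 'cV[R]_p,
            lasso_kkt X beta0 (epsv omega) lambda betah &
            Num.sqrt (s0%:R / kappa ^+ 2) * Num.sqrt (lambda ^+ 2 / n%:R)
              - Num.sqrt s0%:R - Num.sqrt (2 * x)
            <= norm2 (X *m (betah - beta0))].
Proof.
move=> S0 s0 epsv r vbar ubar zstar kappa s0_gt0 Gu iid _ t0 v_lt bstarmin bmin.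
move=> kappa0 betamin x x0.
have p0 : (0 < p)%N.
  by have /card_gt0P[j _] := s0_gt0; apply: leq_ltn_trans (ltn_ord j).
have p0R : 0 < p%:R :> R by rewrite ltr0n.
have ln2p : 0 <= ln (2 * p%:R) :> R.
  by rewrite ln_ge0// -natrM ler1n muln_gt0.
have r2 : r ^+ 2 = 2 * (ln (2 * p%:R) + t).
  by rewrite sqr_sqrtr// mulr_ge0// addr_ge0// ltW.
have r0 : 0 <= r by exact: sqrtr_ge0.
have lam0 : 0 < lambda by apply: le_lt_trans v_lt; rewrite mulr_ge0.
have vvecP k : 0 <= vvec X S0 k 0 by rewrite mxE sqrtr_ge0.
have vbar01 k : 0 <= vbar k 0 < 1.
  rewrite mxE mulr_ge0 ?divr_ge0 ?(ltW lam0)//= mulrAC ltr_pdivrMr// mul1r.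
  apply: le_lt_trans v_lt; rewrite mulrC ler_wpM2r//.
  by rewrite (le_trans (ler_norm _))// le_mx_norm.
pose A1 := (xsub X (~: S0))^T *m (1%:M - colproj X S0).
pose A2 := invmx (gram X S0) *m (xsub X S0)^T.
have [U UU projE] := orthonormal_factor Gu.
pose bad (c : 'cV[R]_n) := [set w | r * norm2 c < `|dotv c (epsv w)|].
pose bad1 k := bad (row k A1)^T; pose bad2 k := bad (row k A2)^T.
pose bad3 := [set w | Num.sqrt s0%:R + Num.sqrt (2 * x) < norm2 (U^T *m epsv w)].
have mbad c : measurable (bad c).
  apply: measurable_lt_set => //.
  by apply: measurableT_comp => //; exact: measurable_dotv.
have mbad3 : measurable bad3.
  rewrite (_ : bad3 = [set w | (Num.sqrt s0%:R + Num.sqrt (2 * x)) ^+ 2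
      < norm2 (U^T *m epsv w) ^+ 2]).
    by apply: measurable_lt_set => //; exact: measurable_norm2_sqr.
  by apply/seteqP; split=> w /=;
    rewrite ltr_sqr ?nnegrE ?norm2_ge0 ?addr_ge0 ?sqrtr_ge0.
(* The tail 2 expR (- r^2 / 2) of one linear form, for r^2 = 2 (ln (2 p) + t). *)
pose q := expR (- t) / p%:R.
have tail c : (P (bad c) <= q%:E)%E.
  apply: (le_trans (gaussian_tail iid c r0)); rewrite lee_fin r2.
  rewrite [2 * (_ + _)]mulrC mulfK// opprD expRD expRN lnK ?posrE ?mulr_gt0//.
  by rewrite /q invfM le_eqVlt; apply/orP; left; apply/eqP; field; rewrite gt_eqF.
have [m1 P1] := measure_bigcup_fin_le (F := bad1) (fun k => mbad _)
  (fun k => tail _).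
have [m2 P2] := measure_bigcup_fin_le (F := bad2) (fun k => mbad _)
  (fun k => tail _).
have P3 : (P bad3 <= (expR (- x))%:E)%E by exact: chi2_tail.
exists (~` (\bigcup_k bad1 k `|` \bigcup_k bad2 k `|` bad3)); split.
- by apply: measurableC; apply: measurableU => //; exact: measurableU.
- rewrite probability_setC; last by apply: measurableU => //; exact: measurableU.
  have : (P (\bigcup_k bad1 k `|` \bigcup_k bad2 k `|` bad3) <=
      (expR (- t) + expR (- x))%:E)%E.
    apply: (le_trans (measureU2 _ _ _)) => //; first exact: measurableU.
    rewrite EFinD leeD//; apply: (le_trans (measureU2 _ _ _)) => //.
    (* The forms indexed by [S0] and by its complement number [p] in all, so together they cost p q
       = expR (- t). *)
    apply: (le_trans (leeD P1 P2)); rewrite -EFinD lee_fin !card_ord -mulrnDr.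
    by rewrite addnC cardsC card_ord -mulr_natr /q divfK ?gt_eqF.
  move=> /(leeB (lexx 1%E)); apply: le_trans.
  by rewrite -EFinB lee_fin opprD addrA.
move=> w /not_orP[/not_orP[nbad1 nbad2] /negP nbad3].
have ev k : `|(X^T *m ((1%:M - colproj X S0) *m epsv w)) (enum_val k) 0|
    <= lambda * vbar k 0.
  have -> : (X^T *m ((1%:M - colproj X S0) *m epsv w)) (enum_val k) 0 =
      dotv (row k A1)^T (epsv w).
    by rewrite -mulmx_row_dotv -mulmxA !mxE; apply: eq_bigr => i _; rewrite !mxE.
  rewrite [vbar k 0]mxE mulrA [lambda * _]mulrC divfK ?gt_eqF//.
  rewrite -(norm2_row_resid Gu) leNgt; apply/negP => bad_w.
  by apply: nbad1; exists k.
have eu k : `|(invmx (gram X S0) *m (xsub X S0)^T *m epsv w) k 0|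
    <= lambda * ubar k 0.
  rewrite mulmx_row_dotv [ubar k 0]mxE mulrA [lambda * _]mulrC divfK ?gt_eqF//.
  rewrite -(norm2_row_invgram Gu) leNgt; apply/negP => bad_w.
  by apply: nbad2; exists k.
have [Xb0 [betah kkt betah_ge]] :=
  lasso_solution s0_gt0 Gu lam0 vbar01 bstarmin bmin betamin ev eu.
exists betah => //; apply: le_trans betah_ge; rewrite -/S0 -addrA -opprD lerB//.
  (* With n = 0 the norm |X bstar| would be an empty sum, against [Xb0]. *)
  have n0 : 0 < n%:R :> R.
    rewrite ltr0n lt0n; apply/negP => /eqP n0.
    move: Xb0; rewrite /norm2 big1 ?sqrtr0 ?ltxx// => i _.
    by have := ltn_ord i; rewrite {2}n0.
  have kappa_ge := kappa_hat_sqr_ge bstarmin; rewrite -/kappa in kappa_ge.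
  have s00 : 0 < s0%:R :> R by rewrite ltr0n.
  rewrite -sqrtrM ?divr_ge0 ?sqr_ge0 ?ler0n//.
  have -> : lambda / norm2 (X *m bstar) =
      Num.sqrt ((lambda / norm2 (X *m bstar)) ^+ 2).
    by rewrite sqrtr_sqr ger0_norm// divr_ge0 ?norm2_ge0// ltW.
  rewrite ler_wsqrtr// expr_div_n mulrACA [s0%:R * _]mulrC -mulrA.
  rewrite ler_wpM2l ?sqr_ge0//.
  rewrite -invfM ler_pdivrMr ?mulr_gt0 ?exprn_gt0// mulrC ler_pdivlMr ?exprn_gt0//.
  by move: kappa_ge; rewrite ler_pdivrMr.
(* The projection is U U^T, and [U] preserves lengths. *)
have -> : norm2 (colproj X S0 *m epsv w) = norm2 (U^T *m epsv w).
  apply/eqP; rewrite -(@eqrXn2 _ 2) ?norm2_ge0// !norm2_sqr /colproj projE.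
  by rewrite -mulmxA dotv_mulmx [U^T *m (U *m _)]mulmxA UU mul1mx.
by rewrite leNgt.
Qed.
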